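(* Let $G$ be a finite group, $k$ a $G$-Tambara functor, and $\ell$ a flat finitely presented $k$-algebra in $G$-Tambara functors. Assume either (1) $\ell$ is cohomological and $|G|$ is invertible in $\ell(G/G)$, or (2) all transfers in $\ell$ are surjective. Then $\ell$ is étale over $k$ if and only if $\ell(G/e)$ is étale over $k(G/e)$.
   Context: Mackey, (commutative) Green and Tambara functors for a finite group $G$ have their standard meaning: a $G$-Tambara functor $k$ has commutative rings $k(X)$ for finite $G$-sets $X$, with restrictions $\mathrm{Res}$, transfers $\mathrm{Tr}$ and norms $\mathrm{Nm}$. A module over a Tambara functor is a module over its underlying Green functor. A $k$-algebra is a Tambara functor $R$ with a morphism $k \to R$. $\boxtimes_k$ is the relative box product over $k$. A Tambara functor is cohomological if $\mathrm{Tr}_H^K \mathrm{Res}_H^K$ is multiplication by $[K:H]$ for all $H \subset K \subset G$. Étale. A $k$-module $M$ is flat if $M \boxtimes_k -$ is exact on $k$-modules; a $k$-algebra is flat if it is so as a $k$-module. The free polynomial $k$-algebra on a generator in level $X$ ($X$ a finite $G$-set) is the $k$-algebra representing $R \mapsto R(X)$. A $k$-algebra is finitely presented if it is the coequalizer of a pair of maps between free polynomial $k$-algebras on finitely many generators. A Tambara ideal is the (levelwise) kernel of a morphism of Tambara functors. For a Tambara ideal $I$, $I^{>1}$ is the sub-ideal of $I$ generated by all nontrivial norms (including products) of elements of $I$: in level $G/H$ by $I(G/H)^2$ together with the images of all norms $I(G/K) \to I(G/H)$ for $K$ conjugate to a proper subgroup of $H$. For a $k$-algebra $R$ with $I = \ker(R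 \boxtimes_k R \to R)$ (multiplication), the genuine Kähler differentials are $\Omega^{1,\mathrm{Tamb}}_{R/k} := I/I^{>1}$. A morphism $k \to R$ is formally étale if $R$ is flat as a $k$-module and $\Omega^{1,\mathrm{Tamb}}_{R/k} = 0$; it is étale if it is moreover finitely presented. For ordinary commutative rings, étale has its classical meaning (the case of the trivial group: flat, finitely presented, with vanishing Kähler differentials). *)

(* Defs.v *)
From HB Require Import structures.
From mathcomp Require Import all_boot all_algebra all_fingroup.
Set Implicit Arguments.
Unset Strict Implicit.
Unset Printing Implicit Defensive.
Import GRing.Theory.
Local Open Scope ring_scope.

(** * Finite G-sets

   [gT : finGroupType] is the whole group G.  As everywhere in MathComp, actions
   are right actions (a left G-set is a right one through [g^-1]), and the orbit
   written G/H on paper is the set of right cosets [H :* x]; the coset [H] has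
   stabiliser [H]. *)

Record gset (gT : finGroupType) := GSet {
  gset_sort :> finType;
  gset_act : {action gT &-> gset_sort}
}.

Record gmap (gT : finGroupType) (X Y : gset gT) := GMap {
  gmap_fun :> X -> Y;
  gmapP : forall x g, gmap_fun (gset_act X x g) = gset_act Y (gmap_fun x) g
}.

Lemma gid_subproof (gT : finGroupType) (X : gset gT) (x : X) (g : gT) :
  id (gset_act X x g) = gset_act X (id x) g.
Proof. by []. Qed.
Definition gid (gT : finGroupType) (X : gset gT) : gmap X X :=
  GMap (@gid_subproof gT X).

Lemma gcomp_subproof (gT : finGroupType) (X Y Z : gset gT)
  (h : gmap Y Z) (f : gmap X Y) (x : X) (g : gT) :
  h (f (gset_act X x g)) = gset_act Z (h (f x)) g.
Proof. by rewrite !gmapP. Qed.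
Definition gcomp (gT : finGroupType) (X Y Z : gset gT)
  (h : gmap Y Z) (f : gmap X Y) : gmap X Z := GMap (gcomp_subproof h f).

Definition coset_type (gT : finGroupType) (H : {group gT}) :=
  {A : {set gT} | A \in rcosets H [set: gT]}.

Lemma coset_act_subproof (gT : finGroupType) (H : {group gT})
  (A : coset_type H) (g : gT) : (val A :* g)%g \in rcosets H [set: gT].
Proof.
have /rcosetsP[x _ ->] := valP A; apply/rcosetsP.
by exists (x * g)%g; rewrite ?inE // rcosetM.
Qed.
Definition coset_act_fun (gT : finGroupType) (H : {group gT})
  (A : coset_type H) (g : gT) : coset_type H :=
  exist (fun B => B \in rcosets H [set: gT]) _ (coset_act_subproof A g).

Lemma coset_act1 (gT : finGroupType) (H : {group gT}) (A : coset_type H) :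
  coset_act_fun A 1%g = A.
Proof. by apply: val_inj; rewrite /= mulg1. Qed.
Lemma coset_actM (gT : finGroupType) (H : {group gT}) (A : coset_type H) :
  act_morph (@coset_act_fun gT H) A.
Proof. by move=> a b; apply: val_inj; rewrite /= rcosetM. Qed.

Definition coset_act (gT : finGroupType) (H : {group gT}) :
  {action gT &-> coset_type H} := TotalAction (@coset_act1 gT H) (@coset_actM gT H).

Definition gorbit (gT : finGroupType) (H : {group gT}) : gset gT :=
  @GSet gT (coset_type H) (coset_act H).

(* The projection G/H -> G/K, [H :* x |-> K * (H :* x) = K :* x]. *)
Lemma gproj_sub_subproof (gT : finGroupType) (H K : {group gT})
  (sHK : H \subset K) (A : gorbit H) : (K * val A)%g \in rcosets K [set: gT].
Proof.
have /rcosetsP[x _ ->] := valP A; apply/rcosetsP.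
by exists x; rewrite ?inE // mulgA mulGSid.
Qed.
Definition gproj_fun (gT : finGroupType) (H K : {group gT})
  (sHK : H \subset K) (A : gorbit H) : gorbit K :=
  exist (fun B => B \in rcosets K [set: gT]) _ (gproj_sub_subproof sHK A).
Lemma gproj_subproof (gT : finGroupType) (H K : {group gT})
  (sHK : H \subset K) (A : gorbit H) (g : gT) :
  gproj_fun sHK (gset_act _ A g) = gset_act _ (gproj_fun sHK A) g.
Proof. by apply: val_inj; rewrite /= mulgA. Qed.
Definition gproj (gT : finGroupType) (H K : {group gT}) (sHK : H \subset K) :
  gmap (gorbit H) (gorbit K) := GMap (gproj_subproof sHK).

(* Coproducts, pullbacks and exponential diagrams of finite G-sets are computed
   on underlying sets, and are described there up to isomorphism. *)

Definition is_coproduct (gT : finGroupType) (X Y Z : gset gT)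
  (i : gmap X Z) (j : gmap Y Z) : Prop :=
  [/\ injective i, injective j, forall x y, i x <> j y
    & forall z, (exists x, i x = z) \/ (exists y, j y = z)].

(*    W --p2--> Y
      |p1       |g
      X --f---> Z     *)
Definition is_pullback (gT : finGroupType) (W X Y Z : gset gT)
  (p1 : gmap W X) (p2 : gmap W Y) (f : gmap X Z) (g : gmap Y Z) : Prop :=
  (forall w, f (p1 w) = g (p2 w)) /\
  (forall x y, f x = g y -> exists! w, p1 w = x /\ p2 w = y).

(*    X <--p-- A <--e-- E
      |f                |f'
      Y <------q------- P
   is exponential: P is the dependent product of A along f, i.e. its points over
   [y] are the sections [s] of [p] over the fibre of [f] at [y]; E is the
   pullback of X and P over Y, and [e] is evaluation of sections. *)
Definition is_exponential (gT : finGroupType) (A X Y E P : gset gT)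
  (p : gmap A X) (f : gmap X Y) (e : gmap E A) (f' : gmap E P) (q : gmap P Y) :
  Prop :=
  is_pullback (gcomp p e) f' f q /\
  forall (y : Y) (s : {x : X | f x == y} -> A),
    (forall u, p (s u) = val u) ->
    exists! z : P, q z = y /\
      forall (w : E) (fw : f (p (e w)) == y), f' w = z ->
        e w = s (exist (fun x => f x == y) (p (e w)) fw).

(** * Mackey, Green and Tambara functors

   Zero rings are needed (the level of the empty G-set is one), hence
   [comPzRingType].  The laws below force sum and product to be the transfer and
   the norm along fold maps. *)

Record mackey_law (gT : finGroupType) (M : gset gT -> zmodType)
  (res : forall X Y, gmap X Y -> M Y -> M X)
  (tr : forall X Y, gmap X Y -> M X -> M Y) : Prop := MackeyLaw {
  mackey_resB : forall X Y (f : gmap X Y) a b,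
    res X Y f (a - b) = res X Y f a - res X Y f b;
  mackey_trB : forall X Y (f : gmap X Y) a b,
    tr X Y f (a - b) = tr X Y f a - tr X Y f b;
  mackey_res_id : forall X a, res X X (gid X) a = a;
  mackey_tr_id : forall X a, tr X X (gid X) a = a;
  mackey_res_comp : forall X Y Z (g : gmap Y Z) (f : gmap X Y) a,
    res X Z (gcomp g f) a = res X Y f (res Y Z g a);
  mackey_tr_comp : forall X Y Z (g : gmap Y Z) (f : gmap X Y) a,
    tr X Z (gcomp g f) a = tr Y Z g (tr X Y f a);
  mackey_base_change : forall W X Y Z
    (p1 : gmap W X) (p2 : gmap W Y) (f : gmap X Z) (g : gmap Y Z),
    is_pullback p1 p2 f g ->
    forall a, res Y Z g (tr X Z f a) = tr W Y p2 (res W X p1 a);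
  mackey_empty : forall X : gset gT, #|X| = 0%N -> forall a : M X, a = 0;
  mackey_coproduct : forall X Y Z (i : gmap X Z) (j : gmap Y Z),
    is_coproduct i j ->
    forall a b, exists! c, res X Z i c = a /\ res Y Z j c = b
}.

Record green (gT : finGroupType) := Green {
  gob :> gset gT -> comPzRingType;
  gres : forall X Y, gmap X Y -> {rmorphism gob Y -> gob X};
  gtr : forall X Y, gmap X Y -> gob X -> gob Y;
  green_mackey : mackey_law (fun X Y (f : gmap X Y) => gres f : _ -> _) gtr;
  green_frobenius : forall X Y (f : gmap X Y) a b,
    gtr f (gres f a * b) = a * gtr f b
}.
Arguments gres {gT} g {X Y} f.
Arguments gtr {gT} g {X Y} f _.

Record tambara (gT : finGroupType) := Tambara {
  tam_green :> green gT;
  gnm : forall X Y, gmap X Y -> tam_green X -> tam_green Y;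
  gnm1 : forall X Y (f : gmap X Y), gnm f 1 = 1;
  gnmM : forall X Y (f : gmap X Y) a b, gnm f (a * b) = gnm f a * gnm f b;
  gnm_id : forall X a, gnm (gid X) a = a;
  gnm_comp : forall X Y Z (g : gmap Y Z) (f : gmap X Y) a,
    gnm (gcomp g f) a = gnm g (gnm f a);
  gnm_base_change : forall W X Y Z
    (p1 : gmap W X) (p2 : gmap W Y) (f : gmap X Z) (g : gmap Y Z),
    is_pullback p1 p2 f g ->
    forall a, gres tam_green g (gnm f a) = gnm p2 (gres tam_green p1 a);
  gnm_tr : forall A X Y E P (p : gmap A X) (f : gmap X Y)
    (e : gmap E A) (f' : gmap E P) (q : gmap P Y),
    is_exponential p f e f' q ->
    forall a, gnm f (gtr tam_green p a)
              = gtr tam_green q (gnm f' (gres tam_green e a))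
}.
Arguments gnm {gT} t {X Y} f _.

Record tmor (gT : finGroupType) (S T : tambara gT) := TMor {
  tmor_fun :> forall X, {rmorphism S X -> T X};
  tmor_res : forall X Y (f : gmap X Y) a,
    tmor_fun X (gres S f a) = gres T f (tmor_fun Y a);
  tmor_tr : forall X Y (f : gmap X Y) a,
    tmor_fun Y (gtr S f a) = gtr T f (tmor_fun X a);
  tmor_nm : forall X Y (f : gmap X Y) a,
    tmor_fun Y (gnm S f a) = gnm T f (tmor_fun X a)
}.

Definition cohomological (gT : finGroupType) (T : tambara gT) : Prop :=
  forall (H K : {group gT}) (sHK : H \subset K) (a : T (gorbit K)),
    gtr T (gproj sHK) (gres T (gproj sHK) a) = a *+ #|K : H|%g.

Definition transfers_surjective (gT : finGroupType) (T : tambara gT) : Prop :=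
  forall (H K : {group gT}) (sHK : H \subset K) (b : T (gorbit K)),
    exists a, gtr T (gproj sHK) a = b.

Definition order_invertible (gT : finGroupType) (T : tambara gT) : Prop :=
  exists u : T (gorbit [set: gT]%G), u * #|gT|%:R = 1.

(** * Modules over a Green functor *)

Record kmod (gT : finGroupType) (k : green gT) := KMod {
  kob :> forall X : gset gT, lmodType (k X);
  kres : forall X Y, gmap X Y -> kob Y -> kob X;
  ktr : forall X Y, gmap X Y -> kob X -> kob Y;
  kmod_mackey : @mackey_law gT (fun X => kob X) kres ktr;
  kresZ : forall X Y (f : gmap X Y) a m,
    kres f (a *: m) = gres k f a *: kres f m;
  ktr_frobeniusl : forall X Y (f : gmap X Y) a m,
    ktr f (gres k f a *: m) = a *: ktr f m;
  ktr_frobeniusr : forall X Y (f : gmap X Y) a m,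
    ktr f (a *: kres f m) = gtr k f a *: m
}.
Arguments kres {gT k} _ {X Y} f _.
Arguments ktr {gT k} _ {X Y} f _.

Record kmor (gT : finGroupType) (k : green gT) (M N : kmod k) := KMor {
  kmor_fun :> forall X, {linear M X -> N X};
  kmor_res : forall X Y (f : gmap X Y) m,
    kmor_fun X (kres M f m) = kres N f (kmor_fun Y m);
  kmor_tr : forall X Y (f : gmap X Y) m,
    kmor_fun Y (ktr M f m) = ktr N f (kmor_fun X m)
}.

(* [kpairing t] says that [t] is a k-bilinear Dress pairing M, N -> P, the notion
   corepresented by the relative box product of M and N over k. *)
Record kpairing (gT : finGroupType) (k : green gT) (M N P : kmod k)
  (t : forall X, M X -> N X -> P X) : Prop := KPairing {
  kpairing_linl : forall X n a m m',
    t X (a *: m + m') n = a *: t X m n + t X m' n;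
  kpairing_linr : forall X m a n n',
    t X m (a *: n + n') = a *: t X m n + t X m n';
  kpairing_res : forall X Y (f : gmap X Y) m n,
    kres P f (t Y m n) = t X (kres M f m) (kres N f n);
  kpairing_trl : forall X Y (f : gmap X Y) m n,
    t Y (ktr M f m) n = ktr P f (t X m (kres N f n));
  kpairing_trr : forall X Y (f : gmap X Y) m n,
    t Y m (ktr N f n) = ktr P f (t X (kres M f m) n)
}.

(* (P, t) is the relative box product of M and N over k. *)
Definition is_box (gT : finGroupType) (k : green gT) (M N P : kmod k)
  (t : forall X, M X -> N X -> P X) : Prop :=
  kpairing t /\
  forall (Q : kmod k) (s : forall X, M X -> N X -> Q X), kpairing s ->
    exists h : kmor P Q,
      (forall X m n, h X (t X m n) = s X m n) /\
      (forall h' : kmor P Q, (forall X m n, h' X (t X m n) = s X m n) ->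
         forall X p, h' X p = h X p).

Definition kshort_exact (gT : finGroupType) (k : green gT) (A B C : kmod k)
  (f : kmor A B) (g : kmor B C) : Prop :=
  forall X, [/\ injective (f X), forall b, g X b = 0 <-> exists a, f X a = b
              & forall c, exists b, g X b = c].

(* Exactness of the functor N |-> M [] N: [f'] and [g'] are the maps induced by
   [f] and [g] on (any choice of) box products. *)
Definition kflat (gT : finGroupType) (k : green gT) (M : kmod k) : Prop :=
  forall (A B C : kmod k) (f : kmor A B) (g : kmor B C), kshort_exact f g ->
  forall (PA PB PC : kmod k) (tA : forall X, M X -> A X -> PA X)
    (tB : forall X, M X -> B X -> PB X) (tC : forall X, M X -> C X -> PC X),
    is_box tA -> is_box tB -> is_box tC ->
  forall (f' : kmor PA PB) (g' : kmor PB PC),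
    (forall X m a, f' X (tA X m a) = tB X m (f X a)) ->
    (forall X m b, g' X (tB X m b) = tC X m (g X b)) ->
    kshort_exact f' g'.

(** * Restriction of scalars *)

Definition rscal (A B : comPzRingType) (phi : {rmorphism A -> B}) : Type := B.

HB.instance Definition _ (A B : comPzRingType) (phi : {rmorphism A -> B}) :=
  GRing.Zmodule.on (rscal phi).

Definition rscal_scale (A B : comPzRingType) (phi : {rmorphism A -> B})
  (a : A) (b : rscal phi) : rscal phi := phi a * (b : B).

Lemma rscal_scaleA (A B : comPzRingType) (phi : {rmorphism A -> B}) (a b : A)
  (v : rscal phi) :
  rscal_scale a (rscal_scale b v) = rscal_scale (a * b) v.
Proof. by rewrite /rscal_scale rmorphM mulrA. Qed.
Lemma rscal_scale1 (A B : comPzRingType) (phi : {rmorphism A -> B}) :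
  left_id 1 (@rscal_scale A B phi).
Proof. by move=> v; rewrite /rscal_scale rmorph1 mul1r. Qed.
Lemma rscal_scaleDr (A B : comPzRingType) (phi : {rmorphism A -> B}) :
  right_distributive (@rscal_scale A B phi) +%R.
Proof. by move=> a u v; rewrite /rscal_scale mulrDr. Qed.
Lemma rscal_scaleDl (A B : comPzRingType) (phi : {rmorphism A -> B})
  (v : rscal phi) :
  {morph (@rscal_scale A B phi)^~ v : a b / a + b}.
Proof. by move=> a b; rewrite /rscal_scale rmorphD mulrDl. Qed.

HB.instance Definition _ (A B : comPzRingType) (phi : {rmorphism A -> B}) :=
  GRing.Zmodule_isLmodule.Build A (rscal phi)
    (@rscal_scaleA A B phi) (@rscal_scale1 A B phi)
    (@rscal_scaleDr A B phi) (@rscal_scaleDl A B phi).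

(** * Algebras over a Tambara functor *)

Record talg (gT : finGroupType) (k : tambara gT) := TAlg {
  talg_tam :> tambara gT;
  talg_str : tmor k talg_tam
}.

Record amor (gT : finGroupType) (k : tambara gT) (R S : talg k) := AMor {
  amor_fun :> tmor R S;
  amor_str : forall X a, amor_fun X (talg_str R X a) = talg_str S X a
}.

Section UnderlyingModule.
Context (gT : finGroupType) (k : tambara gT) (R : talg k).

Definition talg_kob (X : gset gT) : lmodType (k X) := rscal (talg_str R X).
Definition talg_kres X Y (f : gmap X Y) (b : talg_kob Y) : talg_kob X :=
  gres R f b.
Definition talg_ktr X Y (f : gmap X Y) (b : talg_kob X) : talg_kob Y :=
  gtr R f b.

Lemma talg_mackey : @mackey_law gT (fun X => talg_kob X) talg_kres talg_ktr.
Proof. by case: (green_mackey R) => *; split. Qed.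
Lemma talg_kresZ X Y (f : gmap X Y) a m :
  talg_kres f (a *: m) = gres k f a *: talg_kres f m.
Proof.
rewrite /talg_kres; change (gres R f (talg_str R Y a * (m : R Y)) =
  talg_str R X (gres k f a) * gres R f m).
by rewrite rmorphM tmor_res.
Qed.
Lemma talg_frobeniusl X Y (f : gmap X Y) a m :
  talg_ktr f (gres k f a *: m) = a *: talg_ktr f m.
Proof.
change (gtr R f (talg_str R X (gres k f a) * (m : R X)) =
  talg_str R Y a * gtr R f m).
by rewrite tmor_res green_frobenius.
Qed.
Lemma talg_frobeniusr X Y (f : gmap X Y) a m :
  talg_ktr f (a *: talg_kres f m) = gtr k f a *: m.
Proof.
change (gtr R f (talg_str R X a * gres R f (m : R Y)) =
  talg_str R Y (gtr k f a) * (m : R Y)).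
by rewrite tmor_tr mulrC green_frobenius mulrC.
Qed.

Definition talg_mod : kmod k :=
  KMod talg_mackey talg_kresZ talg_frobeniusl talg_frobeniusr.
End UnderlyingModule.

Definition tflat (gT : finGroupType) (k : tambara gT) (R : talg k) : Prop :=
  kflat (talg_mod R).

(* F is the free polynomial k-algebra on generators [x i] in level [L i]. *)
Definition is_free_talg (gT : finGroupType) (k : tambara gT) (n : nat)
  (L : 'I_n -> gset gT) (F : talg k) (x : forall i, F (L i)) : Prop :=
  forall (R : talg k) (r : forall i, R (L i)),
    exists h : amor F R,
      (forall i, h (L i) (x i) = r i) /\
      (forall h' : amor F R, (forall i, h' (L i) (x i) = r i) ->
         forall X a, h' X a = h X a).

Definition is_coequalizer (gT : finGroupType) (k : tambara gT)
  (F1 F0 R : talg k) (u v : amor F1 F0) (q : amor F0 R) : Prop :=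
  (forall X a, q X (u X a) = q X (v X a)) /\
  forall (S : talg k) (h : amor F0 S), (forall X a, h X (u X a) = h X (v X a)) ->
    exists hq : amor R S,
      (forall X a, hq X (q X a) = h X a) /\
      (forall h' : amor R S, (forall X a, h' X (q X a) = h X a) ->
         forall X b, h' X b = hq X b).

Definition finitely_presented (gT : finGroupType) (k : tambara gT) (R : talg k) :
  Prop :=
  exists (n1 n0 : nat) (L1 : 'I_n1 -> gset gT) (L0 : 'I_n0 -> gset gT)
    (F1 F0 : talg k) (x1 : forall i, F1 (L1 i)) (x0 : forall i, F0 (L0 i))
    (u v : amor F1 F0) (q : amor F0 R),
    [/\ is_free_talg x1, is_free_talg x0 & is_coequalizer u v q].

(* P, with the maps [i1] and [i2] from the two factors, is R [] R as a Tambara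
   functor: its underlying k-module is the relative box product, with universal
   pairing [a, b |-> i1 a * i2 b].  (The norms of P are forced by those of R.) *)
Definition is_box_square (gT : finGroupType) (k : tambara gT) (R P : talg k)
  (i1 i2 : amor R P) : Prop :=
  @is_box gT k (talg_mod R) (talg_mod R) (talg_mod P)
    (fun X (a b : R X) => i1 X a * i2 X b).

Definition is_multiplication (gT : finGroupType) (k : tambara gT) (R P : talg k)
  (i1 i2 : amor R P) (mu : amor P R) : Prop :=
  forall X (a b : R X), mu X (i1 X a * i2 X b) = a * b.

Definition levels (gT : finGroupType) (T : tambara gT) :=
  forall X : gset gT, T X -> Prop.

Definition tkernel (gT : finGroupType) (S T : tambara gT) (f : tmor S T) :
  levels S := fun X a => f X a = 0.

Definition tambara_ideal (gT : finGroupType) (S : tambara gT) (J : levels S) :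
  Prop :=
  exists (T : tambara gT) (f : tmor S T), forall X a, J X a <-> tkernel f a.

Definition norm_generators_in (gT : finGroupType) (S : tambara gT)
  (I J : levels S) : Prop :=
  (forall (H : {group gT}) (a b : S (gorbit H)),
     I _ a -> I _ b -> J _ (a * b)) /\
  (forall (K H : {group gT}) (f : gmap (gorbit K) (gorbit H)),
     (exists g : gT, (K :^ g)%g \proper H) ->
     forall a, I _ a -> J _ (gnm S f a)).

(* I^{>1}, the smallest Tambara ideal containing the products and the nontrivial
   norms of elements of I. *)
Definition ideal_gt1 (gT : finGroupType) (S : tambara gT) (I : levels S) :
  levels S :=
  fun X a => forall J : levels S,
    tambara_ideal J -> norm_generators_in I J -> J X a.

(* I / I^{>1} = 0, where I is the kernel of the multiplication R [] R -> R. *)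
Definition kahler_vanish (gT : finGroupType) (k : tambara gT) (R : talg k) :
  Prop :=
  forall (P : talg k) (i1 i2 : amor R P) (mu : amor P R),
    is_box_square i1 i2 -> is_multiplication i1 i2 mu ->
    forall X (a : P X), tkernel mu a -> ideal_gt1 (tkernel mu) a.

Definition formally_etale (gT : finGroupType) (k : tambara gT) (R : talg k) :
  Prop := tflat R /\ kahler_vanish R.

Definition etale (gT : finGroupType) (k : tambara gT) (R : talg k) : Prop :=
  formally_etale R /\ finitely_presented R.

(** * Etale maps of commutative rings

   These definitions are the ones above, for the trivial group. *)

Record bilinear_map (A : comPzRingType) (M N P : lmodType A) (t : M -> N -> P) :
  Prop := BilinearMap {
  bilinear_linl : forall n a m m', t (a *: m + m') n = a *: t m n + t m' n;
  bilinear_linr : forall m a n n', t m (a *: n + n') = a *: t m n + t m n'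
}.

Definition is_tensor (A : comPzRingType) (M N P : lmodType A) (t : M -> N -> P) :
  Prop :=
  bilinear_map t /\
  forall (Q : lmodType A) (s : M -> N -> Q), bilinear_map s ->
    exists h : {linear P -> Q},
      (forall m n, h (t m n) = s m n) /\
      (forall h' : {linear P -> Q}, (forall m n, h' (t m n) = s m n) -> h' =1 h).

Definition short_exact (A : comPzRingType) (M N P : lmodType A)
  (f : {linear M -> N}) (g : {linear N -> P}) : Prop :=
  [/\ injective f, forall b, g b = 0 <-> exists a, f a = b
    & forall c, exists b, g b = c].

Definition flat_module (A : comPzRingType) (M : lmodType A) : Prop :=
  forall (N1 N2 N3 : lmodType A) (f : {linear N1 -> N2}) (g : {linear N2 -> N3}),
    short_exact f g ->
  forall (P1 P2 P3 : lmodType A) (t1 : M -> N1 -> P1) (t2 : M -> N2 -> P2)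
    (t3 : M -> N3 -> P3), is_tensor t1 -> is_tensor t2 -> is_tensor t3 ->
  forall (f' : {linear P1 -> P2}) (g' : {linear P2 -> P3}),
    (forall m n, f' (t1 m n) = t2 m (f n)) ->
    (forall m n, g' (t2 m n) = t3 m (g n)) ->
    short_exact f' g'.

Record calg (A : comPzRingType) := CAlg {
  calg_ring :> comPzRingType;
  calg_str : {rmorphism A -> calg_ring}
}.

Record cmor (A : comPzRingType) (B C : calg A) := CMor {
  cmor_fun :> {rmorphism B -> C};
  cmor_str : forall a, cmor_fun (calg_str B a) = calg_str C a
}.

Definition calg_mod (A : comPzRingType) (B : calg A) : lmodType A :=
  rscal (calg_str B).

(* F is the polynomial algebra over A in the variables [x i]. *)
Definition is_free_calg (A : comPzRingType) (n : nat) (F : calg A)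
  (x : 'I_n -> F) : Prop :=
  forall (B : calg A) (b : 'I_n -> B),
    exists h : cmor F B,
      (forall i, h (x i) = b i) /\
      (forall h' : cmor F B, (forall i, h' (x i) = b i) -> h' =1 h).

Definition is_ccoequalizer (A : comPzRingType) (F1 F0 B : calg A)
  (u v : cmor F1 F0) (q : cmor F0 B) : Prop :=
  (forall a, q (u a) = q (v a)) /\
  forall (C : calg A) (h : cmor F0 C), (forall a, h (u a) = h (v a)) ->
    exists hq : cmor B C,
      (forall a, hq (q a) = h a) /\
      (forall h' : cmor B C, (forall a, h' (q a) = h a) -> h' =1 hq).

Definition ring_finitely_presented (A : comPzRingType) (B : calg A) : Prop :=
  exists (n1 n0 : nat) (F1 F0 : calg A) (x1 : 'I_n1 -> F1) (x0 : 'I_n0 -> F0)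
    (u v : cmor F1 F0) (q : cmor F0 B),
    [/\ is_free_calg x1, is_free_calg x0 & is_ccoequalizer u v q].

(* The ideal I^2, for an ideal I of S. *)
Definition ideal_square (S : comPzRingType) (I : S -> Prop) (a : S) : Prop :=
  exists s : seq (S * S),
    (forall p, p \in s -> I p.1 /\ I p.2) /\ a = \sum_(p <- s) p.1 * p.2.

(* I / I^2 = 0, where I is the kernel of the multiplication from the tensor
   square P of B over A to B. *)
Definition ring_kahler_vanish (A : comPzRingType) (B : calg A) : Prop :=
  forall (P : calg A) (i1 i2 : cmor B P) (mu : cmor P B),
    @is_tensor A (calg_mod B) (calg_mod B) (calg_mod P)
      (fun a b : B => i1 a * i2 b) ->
    (forall a b : B, mu (i1 a * i2 b) = a * b) ->
    forall p : P, mu p = 0 -> ideal_square (fun a => mu a = 0) p.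

Definition ring_etale (A : comPzRingType) (B : calg A) : Prop :=
  [/\ flat_module (calg_mod B), ring_finitely_presented B
    & ring_kahler_vanish B].

(* R(G/e), as an algebra over k(G/e). *)
Definition underlying_calg (gT : finGroupType) (k : tambara gT) (R : talg k) :
  calg (k (gorbit 1%G)) := CAlg (talg_str R (gorbit 1%G)).

(* Main.v *)
Require Import Defs.
From HB Require Import structures.
From mathcomp Require Import all_boot all_algebra all_fingroup.
From mathcomp Require Import boolp.

(** Evaluation at G/e, from k-algebras to k(G/e)-algebras, has the right adjoint
   S |-> (X |-> S^X), with fibrewise sums and products as transfers and norms;
   hence it preserves free algebras and coequalizers, so finite presentation
   descends.  On modules, N |-> Ind N = (X |-> N^X) is both left and right
   adjoint to evaluation at G/e; it preserves and reflects exactness and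
   M [] Ind N = Ind (M(G/e) (x) N), so flatness descends as well, and P(G/e) is
   the tensor square of R(G/e) whenever P is the box square of R.

   Either hypothesis on l gives alpha in l(G/e) with transfer 1 in l(G/G).  By
   Frobenius reciprocity every b in R(X), for R an l-algebra, is then the sum over
   the points x of X of tr_x (alpha * res_x b), where x is seen as a map G/e -> X.
   So elements of R are detected at G/e and R is the fixed point functor of R(G/e).
   If the kernel I of l [] l -> l satisfies I(G/e) = I(G/e)^2, an ideal
   containing the products of elements of I therefore contains I.  Conversely
   l [] l is the fixed point functor of S = l(G/e) (x) l(G/e); with I0 the kernel of
   S -> l(G/e), the functions with values in I0^2 form a Tambara ideal containing
   I^{>1}, because a nontrivial norm is a product over fibres with at least two
   points. *)

Set Implicit Arguments.
Unset Strict Implicit.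
Unset Printing Implicit Defensive.
Import GRing.Theory.
Local Open Scope ring_scope.

(** * Finite G-sets and Mackey functors *)

Section GSets.
Context {gT : finGroupType}.
Implicit Types X Y Z : gset gT.

Lemma gmap_ext X Y (f g : gmap X Y) : f =1 g -> f = g.
Proof.
case: f g => [f fP] [g gP] /= /funext efg.
by case: g / efg gP => gP; congr GMap; apply: Prop_irrelevance.
Qed.

(* The orbit G/e. *)
Definition G1 : gset gT := gorbit 1%G.

Lemma gel_subproof (g : gT) : (1%G :* g)%g \in rcosets 1%G [set: gT].
Proof. by apply/rcosetsP; exists g; rewrite ?inE. Qed.
Definition gel (g : gT) : G1 :=
  exist (fun A => A \in rcosets 1%G [set: gT]) _ (gel_subproof g).
Definition gpt (a : G1) : gT := repr (val a).

Lemma gelK : cancel gel gpt.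
Proof. by move=> g; rewrite /gpt /= mul1g -[RHS](repr_set1 g). Qed.
Lemma gptK : cancel gpt gel.
Proof.
move=> a; have /rcosetsP[x _ ax] := valP a.
by have ->: a = gel x; [exact: val_inj | rewrite gelK].
Qed.
Lemma gel_act x g : gset_act G1 (gel x) g = gel (x * g)%g.
Proof. by apply: val_inj; rewrite /= rcosetM. Qed.
Lemma gpt_act a g : gpt (gset_act G1 a g) = (gpt a * g)%g.
Proof. by rewrite -{1}[a]gptK gel_act gelK. Qed.

Lemma orb_subproof X (x : X) (a : G1) g :
  gset_act X x (gpt (gset_act G1 a g)) = gset_act X (gset_act X x (gpt a)) g.
Proof. by rewrite gpt_act actM. Qed.
(** The map out of G/e classifying the point x. By [gmap_orb] every map out of G/e has this form, so
    restriction along [orb x] is the value at x. *)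
Definition orb X (x : X) : gmap G1 X := GMap (orb_subproof x).

Lemma gcomp_orb X Y (f : gmap X Y) (x : X) : gcomp f (orb x) = orb (f x).
Proof. by apply: gmap_ext => a /=; rewrite gmapP. Qed.
Lemma orb1 : orb (gel 1%g) = gid G1.
Proof. by apply: gmap_ext => a; rewrite [LHS]gel_act mul1g gptK. Qed.
Lemma orb_gel1 X (x : X) : orb x (gel 1%g) = x.
Proof. by rewrite /= gelK act1. Qed.
Lemma gcomp_orb_gel X (x : X) g : gcomp (orb x) (orb (gel g)) = orb (gset_act X x g).
Proof. by rewrite gcomp_orb /= gelK. Qed.
Lemma gmap_orb X (f : gmap G1 X) : f = orb (f (gel 1%g)).
Proof. by rewrite -gcomp_orb orb1; apply: gmap_ext. Qed.

(** * Free G-sets with a given finite set of orbits *)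

Section Free.
Variable S : finType.
Definition gfree_fun (w : G1 * S) (g : gT) : G1 * S := (gset_act G1 w.1 g, w.2).
Lemma gfree_act1 w : gfree_fun w 1%g = w.
Proof. by case: w => a s; rewrite /gfree_fun act1. Qed.
Lemma gfree_actM w : act_morph gfree_fun w.
Proof. by move=> g h; rewrite /gfree_fun actM. Qed.
Definition gfree : gset gT := GSet (TotalAction gfree_act1 gfree_actM).
Definition gincl (s : S) : gmap G1 gfree :=
  @GMap gT G1 gfree (fun a => (a, s)) (fun a g => erefl).
Definition gfst : gmap gfree G1 := @GMap gT gfree G1 fst (fun w g => erefl).
Lemma gfree_orb X (F : S -> X) :
  {f : gmap gfree X | forall s, gcomp f (gincl s) = orb (F s)}.
Proof.
have fP (w : gfree) g : orb (F (gset_act gfree w g).2) (gset_act gfree w g).1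
    = gset_act X (orb (F w.2) w.1) g by rewrite -gmapP.
by exists (GMap fP) => s; apply: gmap_ext.
Qed.
End Free.

Definition gvoid_fun (w : void) (g : gT) : void := w.
Definition gvoid : gset gT :=
  @GSet gT void (@TotalAction _ _ gvoid_fun (fun w => match w with end)
    (fun w => match w with end)).
Definition gvoid_map X : gmap gvoid X :=
  @GMap gT gvoid X (fun w : void => match w with end) (fun w => match w with end).

(* The pullback is G/e times the fibre over [y]; its decomposition into orbits gives
   the double coset formulas below. *)
Lemma orb_pullback X Y (f : gmap X Y) (y : Y) :
  exists p : gmap (gfree {x : X | f x == y}) X,
    is_pullback p (gfst _) f (orb y) /\ forall s, gcomp p (gincl s) = orb (val s).
Proof.
have [p pP] := gfree_orb (fun s : {x : X | f x == y} => val s).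
have pE (w : gfree {x : X | f x == y}) : p w = orb (val w.2) w.1.
  by rewrite -pP /=; case: w.
exists p; split=> //; split=> [w|x a fx] /=.
  by rewrite pE /= gmapP (eqP (valP w.2)).
have fx' : f (gset_act X x (gpt a)^-1)%g == y.
  by rewrite gmapP fx /= actK.
exists (a, exist (fun x => f x == y) _ fx'); split.
  by rewrite pE /= actKV.
case=> b s [] /=; rewrite pE /= => xE ba; rewrite ba in xE *.
by congr pair; apply: val_inj => /=; rewrite -xE actK.
Qed.

Lemma pullback_sym W X Y Z (p1 : gmap W X) (p2 : gmap W Y) (f : gmap X Z) (g : gmap Y Z) :
  is_pullback p1 p2 f g -> is_pullback p2 p1 g f.
Proof.
case=> c u; split=> [w|y x e]; first by rewrite c.
by have [w [[w1 w2] wu]] := u x y (esym e); exists w; split=> // w' [? ?]; apply: wu.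
Qed.

Lemma gincl_pullback (S : finType) (s : S) :
  is_pullback (gid G1) (gid G1) (gincl s) (gincl s).
Proof.
by split=> // x y [xy]; exists x; rewrite xy; split=> // w [].
Qed.
Lemma gincl_disjoint (S : finType) (s t : S) : s != t ->
  is_pullback (gvoid_map G1) (gvoid_map G1) (gincl s) (gincl t).
Proof.
move=> st; split=> [[]|x y [_ e]]; first by rewrite e eqxx in st.
Qed.

(** Splits off one copy of G/e, the induction step of [gfree_separated]. *)
Lemma gfree_coproduct (S : finType) (s : S) :
  exists j : gmap (gfree {t : S | t != s}) (gfree S),
   is_coproduct (gincl s) j /\ forall t, gcomp j (gincl t) = gincl (val t).
Proof.
exists (@GMap gT (gfree {t : S | t != s}) (gfree S) (fun w => (w.1, val w.2))
  (fun w g => erefl)).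
split; last by move=> t; apply: gmap_ext.
split=> [a b [] //|[a t] [b u] /= [-> e]|a [b [t ts]] /= [_ e]|[a t]].
- by congr pair; apply: val_inj.
- by rewrite -e eqxx in ts.
have [->|ts] := eqVneq t s; first by left; exists a.
by right; exists (a, exist (fun t => t != s) t ts).
Qed.

End GSets.
Arguments G1 {gT}.
Arguments gfree_coproduct gT {S} s.
Arguments gfree gT S : clear implicits.

(** * Mackey functors on free G-sets and double coset formulas at G/e *)

Section Mackey.
Context {gT : finGroupType} (M : gset gT -> zmodType).
Context (res : forall X Y, gmap X Y -> M Y -> M X) (tr : forall X Y, gmap X Y -> M X -> M Y).
Hypothesis hM : mackey_law res tr.
Implicit Types X Y : gset gT.

Lemma mackey_res0 X Y (f : gmap X Y) : res f 0 = 0.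
Proof. by have := mackey_resB hM f 0 0; rewrite !subrr. Qed.
Lemma mackey_tr0 X Y (f : gmap X Y) : tr f 0 = 0.
Proof. by have := mackey_trB hM f 0 0; rewrite !subrr. Qed.
Lemma mackey_resD X Y (f : gmap X Y) a b : res f (a + b) = res f a + res f b.
Proof.
have := mackey_resB hM f a (0 - b).
by rewrite (mackey_resB hM f 0 b) mackey_res0 !sub0r !opprK.
Qed.
Lemma mackey_trD X Y (f : gmap X Y) a b : tr f (a + b) = tr f a + tr f b.
Proof.
have := mackey_trB hM f a (0 - b).
by rewrite (mackey_trB hM f 0 b) mackey_tr0 !sub0r !opprK.
Qed.
Lemma mackey_res_sum X Y (f : gmap X Y) (I : Type) r (P : pred I) F :
  res f (\sum_(i <- r | P i) F i) = \sum_(i <- r | P i) res f (F i).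
Proof. exact: (big_morph _ (@mackey_resD X Y f) (mackey_res0 f)). Qed.
Lemma mackey_tr_sum X Y (f : gmap X Y) (I : Type) r (P : pred I) F :
  tr f (\sum_(i <- r | P i) F i) = \sum_(i <- r | P i) tr f (F i).
Proof. exact: (big_morph _ (@mackey_trD X Y f) (mackey_tr0 f)). Qed.

(** Induction on the number of copies of G/e: the coproduct axiom determines an element by its
    restrictions to one copy and to the others, and the empty G-set has the zero group. *)
Lemma gfree_separated n (S : finType) : #|S| = n -> forall c d : M (gfree gT S),
  (forall s, res (gincl s) c = res (gincl s) d) -> c = d.
Proof.
elim: n S => [|n IH] S nS c d cd.
  have E : #|gfree gT S| = 0%N.
    apply/eqP; rewrite -leqn0 leqNgt.
    by apply/card_gt0P => -[[a s] _]; case: (fintype0 s nS).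
  by rewrite (mackey_empty hM E c) (mackey_empty hM E d).
have /card_gt0P[s _] : (0 < #|S|)%N by rewrite nS.
have [j [jc jP]] := gfree_coproduct gT s.
have [z [_ zU]] := mackey_coproduct hM jc (res (gincl s) c) (res j c).
have <- : z = c by apply: zU.
apply: zU; split=> //; apply: IH => [|t].
  by rewrite card_sig; have := cardC1 s; rewrite nS /= => <-; apply: eq_card.
by rewrite -!(mackey_res_comp hM) jP.
Qed.

(** Two copies of G/e have pullback G/e if they coincide and the empty G-set otherwise; in the
    latter case base change passes through the zero group. *)
Lemma res_tr_gincl (S : finType) (s t : S) (d : M G1) :
  res (gincl t) (tr (gincl s) d) = if s == t then d else 0.
Proof.
case: eqVneq => [->|st].
  rewrite (mackey_base_change hM (gincl_pullback t)).
  by rewrite (mackey_res_id hM) (mackey_tr_id hM).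
rewrite (mackey_base_change hM (gincl_disjoint st)).
have E : #|@gvoid gT| = 0%N by rewrite -card_void.
by rewrite [res _ _](mackey_empty hM E) mackey_tr0.
Qed.

Lemma gfree_decomp (S : finType) (c : M (gfree gT S)) :
  c = \sum_s tr (gincl s) (res (gincl s) c).
Proof.
apply: (gfree_separated erefl) => t; rewrite mackey_res_sum.
rewrite (bigD1 t) //= res_tr_gincl eqxx big1 ?addr0 // => s st.
by rewrite res_tr_gincl (negPf st).
Qed.

Lemma mackey_res_orb_tr X Y (f : gmap X Y) (y : Y) (a : M X) :
  res (orb y) (tr f a) = \sum_(x | f x == y) res (orb x) a.
Proof.
have [p [pb pP]] := orb_pullback f y.
rewrite (mackey_base_change hM pb) [res p a]gfree_decomp mackey_tr_sum.
rewrite [RHS](reindex_omap (val : {x : X | f x == y} -> X) insub) /=; last first.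
  by move=> x fx; rewrite insubT.
apply: eq_big => [[x fx]|s _]; first by rewrite insubT fx /= eqxx.
rewrite -(mackey_tr_comp hM) -(mackey_res_comp hM) pP.
by rewrite (_ : gcomp _ _ = gid _) ?(mackey_tr_id hM) //; apply: gmap_ext.
Qed.

Lemma mackey_res_tr_orb X Y (f : gmap X Y) (y : Y) (d : M G1) :
  res f (tr (orb y) d) = \sum_(x | f x == y) tr (orb x) d.
Proof.
have [p [pb pP]] := orb_pullback f y.
rewrite (mackey_base_change hM (pullback_sym pb)) [res (gfst _) d]gfree_decomp mackey_tr_sum.
rewrite [RHS](reindex_omap (val : {x : X | f x == y} -> X) insub) /=; last first.
  by move=> x fx; rewrite insubT.
apply: eq_big => [[x fx]|s _]; first by rewrite insubT fx /= eqxx.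
rewrite -(mackey_tr_comp hM) -(mackey_res_comp hM) pP.
by rewrite (_ : gcomp _ _ = gid _) ?(mackey_res_id hM) //; apply: gmap_ext.
Qed.

End Mackey.

(** * Norms at level G/e and elements with unit transfer *)

Section Tambara.
Context {gT : finGroupType} (T : tambara gT).
Implicit Types X Y : gset gT.
Let hT := green_mackey T.

Lemma res_nm_gincl (S : finType) (s t : S) (d : T G1) :
  gres T (gincl t) (gnm T (gincl s) d) = if s == t then d else 1.
Proof.
case: eqVneq => [->|st].
  rewrite (gnm_base_change (gincl_pullback t)).
  by rewrite (mackey_res_id hT) gnm_id.
rewrite (gnm_base_change (gincl_disjoint st)).
(* At the empty G-set 0 = 1, so the restricted element may be replaced by 1, whose norm is 1. *)
have E : #|@gvoid gT| = 0%N by rewrite -card_void.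
rewrite [gres _ _ _](mackey_empty hT E).
by rewrite -[X in gnm _ _ X](mackey_empty hT E 1) gnm1.
Qed.

Lemma gnm_prod X Y (f : gmap X Y) (I : Type) r (P : pred I) F :
  gnm T f (\prod_(i <- r | P i) F i) = \prod_(i <- r | P i) gnm T f (F i).
Proof. by elim/big_rec2: _ => [|i x y _ <-]; rewrite ?gnm1 ?gnmM. Qed.

Lemma gfree_prod_decomp (S : finType) (c : T (gfree gT S)) :
  c = \prod_s gnm T (gincl s) (gres T (gincl s) c).
Proof.
apply: (gfree_separated hT erefl) => t; rewrite rmorph_prod.
rewrite (bigD1 t) //= res_nm_gincl eqxx big1 ?mulr1 // => s st.
by rewrite res_nm_gincl (negPf st).
Qed.

Lemma res_orb_nm X Y (f : gmap X Y) (y : Y) (a : T X) :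
  gres T (orb y) (gnm T f a) = \prod_(x | f x == y) gres T (orb x) a.
Proof.
have [p [pb pP]] := orb_pullback f y.
rewrite (gnm_base_change pb) [gres T p a]gfree_prod_decomp gnm_prod.
rewrite [RHS](reindex_omap (val : {x : X | f x == y} -> X) insub) /=; last first.
  by move=> x fx; rewrite insubT.
apply: eq_big => [[x fx]|s _]; first by rewrite insubT fx /= eqxx.
rewrite -gnm_comp -(mackey_res_comp hT) pP.
by rewrite (_ : gcomp _ _ = gid _) ?gnm_id //; apply: gmap_ext.
Qed.

(** For X = G/G this says that [alpha] has transfer 1; for general X it is the pullback of that
    relation to X. *)
Definition unit_transfer (alpha : T G1) :=
  forall X, \sum_(x : X) gtr T (orb x) alpha = 1.

(** Restriction along X -> G/G preserves 1, and the double coset formula turns the one transfer into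
    a sum over all points of X. *)
Lemma unit_transferP (alpha : T G1) :
  gtr T (gproj (sub1G [set: gT]%G)) alpha = 1 -> unit_transfer alpha.
Proof.
move=> tr1 X.
pose P := gorbit [set: gT]%G.
have P1 (a b : P) : a = b.
  apply: val_inj; have /rcosetsP[x xG ->] := valP a; have /rcosetsP[y yG ->] := valP b.
  by rewrite !rcoset_id.
pose t : P := gproj (sub1G [set: gT]%G) (gel 1%g).
have cP (x : X) g : t = gset_act P t g by exact: P1.
pose c : gmap X P := GMap cP.
have := congr1 (gres T c) tr1; rewrite rmorph1 => <-.
rewrite [gproj _]gmap_orb (mackey_res_tr_orb hT).
by apply: eq_bigl => x; apply/esym/eqP.
Qed.

Section UnitTransfer.
Variable alpha : T G1.
Hypothesis alphaP : unit_transfer alpha.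

(** Multiply b by the expression of 1 as a sum of transfers and apply Frobenius reciprocity. *)
Lemma unit_transfer_decomp X (b : T X) :
  b = \sum_(x : X) gtr T (orb x) (alpha * gres T (orb x) b).
Proof.
rewrite -[LHS]mulr1 -(alphaP X) mulr_sumr; apply: eq_bigr => x _.
by rewrite -green_frobenius mulrC.
Qed.

Lemma unit_transfer_inj X (b c : T X) :
  (forall x : X, gres T (orb x) b = gres T (orb x) c) -> b = c.
Proof.
move=> bc; rewrite [b]unit_transfer_decomp [c]unit_transfer_decomp.
by apply: eq_bigr => x _; rewrite bc.
Qed.

(** The relation for X = G/e, restricted to the base point: the conjugates of [alpha] under G add up
    to 1. *)
Lemma unit_transfer_trace : \sum_(a : G1) gres T (orb a) alpha = 1.
Proof.
rewrite -(rmorph1 (gres T (orb (gel 1%g)))) -(alphaP G1) rmorph_sum /=.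
under [RHS]eq_bigr do rewrite (mackey_res_orb_tr hT).
rewrite (exchange_big_dep predT) //=; apply: eq_bigr => a _.
(* After the exchange of sums, each a is sent to the base point by [orb x] for a single x, the
   inverse of a. *)
rewrite (big_pred1 (gel (gpt a)^-1)) // => x.
rewrite -[X in X == _]/(gset_act G1 x (gpt a)).
apply/eqP/eqP => [e|->]; last by rewrite gel_act mulVg.
by rewrite -[x](actK (gset_act G1) (gpt a)) e gel_act mul1g.
Qed.

End UnitTransfer.
End Tambara.

(** * Sums and products over fibres *)

Section Fibre.
Context {gT : finGroupType} (V : Type) (idx : V) (op : Monoid.com_law idx).
Implicit Types X Y Z : gset gT.
Local Notation "\fib_ ( x | P ) F" := (\big[op/idx]_(x | P) F)
  (at level 36, x at level 50).

Lemma fibre_id X (psi : X -> V) y : \fib_(x | gid X x == y) psi x = psi y.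
Proof. exact: big_pred1_eq. Qed.

Lemma fibre_comp X Y Z (g : gmap Y Z) (f : gmap X Y) (psi : X -> V) z :
  \fib_(x | gcomp g f x == z) psi x = \fib_(y | g y == z) \fib_(x | f x == y) psi x.
Proof.
rewrite (partition_big f (fun y => g y == z)) //=.
apply: eq_bigr => y /eqP gy; apply: eq_bigl => x.
by case: (f x =P y) => [->|]; rewrite ?gy ?eqxx // andbF.
Qed.

(** In a pullback square [p1] maps the fibre of [p2] over y bijectively onto the fibre of f over g
    y; [r] is the inverse. *)
Lemma fibre_base_change W X Y Z (p1 : gmap W X) (p2 : gmap W Y) (f : gmap X Z)
    (g : gmap Y Z) : is_pullback p1 p2 f g -> forall (psi : X -> V) y,
  \fib_(x | f x == g y) psi x = \fib_(w | p2 w == y) psi (p1 w).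
Proof.
case=> fg pbu psi y.
pose r x := [pick w | (p1 w == x) && (p2 w == y)].
rewrite (reindex_omap p1 r) => [|x /eqP fx]; last first.
  have [w [[w1 w2] _]] := pbu x y fx; rewrite /r; case: pickP => [v /andP[/eqP<-] //|/(_ w)].
  by rewrite w1 w2 !eqxx.
apply: eq_bigl => w; rewrite /r.
have [<-|w2] := eqVneq (p2 w) y.
  rewrite fg eqxx /=; case: pickP => [v /andP[/eqP v1 /eqP v2]|/(_ w)]; last by rewrite !eqxx.
  have [u [_ uu]] := pbu _ _ (fg w).
  by rewrite -(uu v) // -(uu w) // eqxx.
case: pickP => [v /andP[/eqP v1 /eqP v2]|]; last by rewrite andbF.
apply/andP => -[_ /eqP[vw]]; by rewrite -vw v2 eqxx in w2.
Qed.

Lemma fibre_act X Y (f : gmap X Y) (psi : X -> V) y g :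
  \fib_(x | f x == gset_act Y y g) psi x = \fib_(x | f x == y) psi (gset_act X x g).
Proof.
rewrite (reindex_inj (act_inj (gset_act X) g)) /=; apply: eq_bigl => x.
by rewrite gmapP (inj_eq (act_inj (gset_act Y) g)).
Qed.

Lemma coproduct_glue X Y Z (i : gmap X Z) (j : gmap Y Z) : is_coproduct i j ->
  forall (a : X -> V) (b : Y -> V),
  {c : Z -> V | forall x, c (i x) = a x & forall y, c (j y) = b y}.
Proof.
case=> ii ij dij cij a b.
have cP z : exists v, (forall x, i x = z -> v = a x) /\ (forall y, j y = z -> v = b y).
  have [[x xz]|[y yz]] := cij z.
    exists (a x); split=> [x'|y]; first by rewrite -xz => /ii ->.
    by move=> yz; have := dij x y; rewrite xz yz.
  exists (b y); split=> [x|y']; last by rewrite -yz => /ij ->.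
  by move=> xz; have := dij x y; rewrite xz yz.
have [c cE] := choice cP.
by exists c => [x|y]; [apply: (cE _).1 | apply: (cE _).2].
Qed.

End Fibre.

(** Distributivity: expanding the product of sums gives a sum over sections of p on the fibre of f
    at y, and these are the points of P over y. *)
Lemma fibre_exponential (gT : finGroupType) (S : comPzRingType)
    (A X Y E P : gset gT) (p : gmap A X) (f : gmap X Y) (e : gmap E A)
    (f' : gmap E P) (q : gmap P Y) :
  is_exponential p f e f' q -> forall (psi : A -> S) y,
  \prod_(x | f x == y) \sum_(a | p a == x) psi a =
  \sum_(z | q z == y) \prod_(w | f' w == z) psi (e w).
Proof.
case=> pb ex psi y; pose U := {x : X | f x == y}.
rewrite (reindex_omap (val : U -> X) insub) => [|x fx] /=; last by rewrite insubT.
rewrite (eq_bigl predT) => [|[x fx]]; last by rewrite insubT fx /= eqxx.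
rewrite bigA_distr_big_dep.
(* [R z s]: the point [z] of the dependent product is the section [s]. *)
pose R z (s : {ffun U -> A}) := [forall u, forall w,
  (f' w == z) && (p (e w) == val u) ==> (e w == s u)].
have RP z (s : {ffun U -> A}) : reflect (forall (w : E) (fw : f (p (e w)) == y), f' w = z ->
    e w = s (exist (fun x => f x == y) (p (e w)) fw)) (R z s).
  apply: (iffP forallP) => [h w fw /eqP f'w|h u].
    by have /forallP/(_ w) := h (exist (fun x => f x == y) _ fw); rewrite f'w eqxx => /eqP.
  apply/forallP => w; apply/implyP => /andP[/eqP f'w /eqP pu].
  have fw : f (p (e w)) == y by rewrite pu (valP u).
  by rewrite {1}(h w fw f'w); apply/eqP; congr (s _); apply: val_inj.
(* Each section is represented by exactly one z, so the inner sum has one term. After the exchange,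
   each z over y again leaves a single section. *)
transitivity (\sum_(s in family (fun (u : U) a => p a == val u))
   \sum_(z | (q z == y) && R z s) \prod_u psi (s u)).
  apply: eq_bigr => s /familyP sf.
  have [|z [[/eqP qz Rz] zU]] := ex y s; first by move=> u; apply/eqP/sf.
  rewrite (big_pred1 z) // => t; apply/andP/eqP => [[/eqP qt /RP Rt]|->].
    by apply/esym/zU.
  by split=> //; apply/RP.
rewrite (exchange_big_dep (fun z => q z == y)) => /= [|s z _ /andP[] //].
apply: eq_bigr => z qz.
have wP (u : U) : exists w, p (e w) = val u /\ f' w = z.
  have [|w [w12 _]] := pb.2 (val u) z; last by exists w.
  by rewrite (eqP qz); apply/eqP/(valP u).
have wU w v : p (e w) = p (e v) -> f' w = z -> f' v = z -> w = v.
  move=> wv wz vz; have [|x [_ xU]] := pb.2 (p (e v)) z; first by rewrite -vz pb.1.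
  by rewrite -(xU w) // -(xU v).
(* [W u] is the point of the pullback E above u and z; evaluating there recovers the section that z
   represents. *)
have [W WP] := choice wP.
pose s := [ffun u => e (W u)].
rewrite (big_pred1 s) => [|t].
  rewrite (reindex_omap W (fun w => insub (p (e w)))) => [|w /eqP wz].
    apply: eq_big => [u|u _]; last by rewrite ffunE.
    by have [-> ->] := WP u; rewrite eqxx valK eqxx.
  have fw : f (p (e w)) == y by rewrite -(eqP qz) -wz; apply/eqP/pb.1.
  rewrite insubT /=; congr Some; have [h1 h2] := WP (Sub (p (e w)) fw).
  exact: wU.
apply/andP/eqP => [[_ /andP[_ /forallP h]]|->].
  apply/ffunP => u; rewrite ffunE; have [h1 h2] := WP u.
  by have /forallP/(_ (W u)) := h u; rewrite h1 h2 !eqxx => /eqP.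
split; first by apply/familyP => u; rewrite ffunE unfold_in; have [-> _] := WP u.
rewrite qz; apply/RP => w fw wz; rewrite ffunE; congr (e _).
by have [h1 h2] := WP (exist (fun x => f x == y) _ fw); apply: wU.
Qed.

(** * Functors of equivariant functions *)

HB.instance Definition _ (aT : finType) (R : comPzRingType) :=
  GRing.PzRing_hasCommutativeMul.Build {ffun aT -> R} (@ffun_mulC aT R).

Section FunTambara.
Context (gT : finGroupType) (S : comPzRingType) (D : {set gT})
  (sigma : gT -> {rmorphism S -> S}).
Implicit Types X Y : gset gT.

Definition equivariant X : {pred {ffun X -> S}} :=
  fun psi => [forall x, forall g in D, psi (gset_act X x g) == sigma g (psi x)].

Lemma equivariantP X (psi : {ffun X -> S}) :
  reflect (forall x g, g \in D -> psi (gset_act X x g) = sigma g (psi x))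
    (psi \in @equivariant X).
Proof.
apply: (iffP forallP) => [h x g gD|h x].
  by have /forallP/(_ g) := h x; rewrite gD => /eqP.
by apply/forallP => g; apply/implyP => gD; rewrite h.
Qed.

Lemma equivariant_subring X : subring_closed (@equivariant X).
Proof.
split=> [|u v /equivariantP hu /equivariantP hv|u v /equivariantP hu /equivariantP hv];
  apply/equivariantP => x g gD; rewrite !ffunE.
- by rewrite rmorph1.
- by rewrite rmorphB hu ?hv.
- by rewrite rmorphM hu ?hv.
Qed.
HB.instance Definition _ X :=
  GRing.isSubringClosed.Build _ (@equivariant X) (@equivariant_subring X).

(* [D = set0] gives all functions X -> S (coinduction from the trivial group),
   [D = setT], with [sigma] an action of G, the equivariant ones (the fixed point
   functor).  That [sigma] is an action is never used for the Tambara axioms. *)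
Record eqfun X := EqFun { eqfun_val : {ffun X -> S}; _ : eqfun_val \in @equivariant X }.
HB.instance Definition _ X := [isSub of eqfun X for @eqfun_val X].
HB.instance Definition _ X := [Choice of eqfun X by <:].
HB.instance Definition _ X :=
  GRing.SubChoice_isSubComPzRing.Build _ _ (eqfun X) (@equivariant_subring X).

Definition ev X (psi : eqfun X) (x : X) : S := eqfun_val psi x.

Lemma ev_ext X (psi phi : eqfun X) : ev psi =1 ev phi -> psi = phi.
Proof. by move=> h; apply: val_inj; apply/ffunP. Qed.
Lemma ev_act X (psi : eqfun X) x g : g \in D -> ev psi (gset_act X x g) = sigma g (ev psi x).
Proof. by apply: equivariantP; case: psi. Qed.
Lemma ev1 X x : ev (1 : eqfun X) x = 1. Proof. by rewrite /ev ffunE. Qed.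
Lemma ev0 X x : ev (0 : eqfun X) x = 0. Proof. by rewrite /ev ffunE. Qed.
Lemma evD X (u v : eqfun X) x : ev (u + v) x = ev u x + ev v x.
Proof. by rewrite /ev ffunE. Qed.
Lemma evB X (u v : eqfun X) x : ev (u - v) x = ev u x - ev v x.
Proof. by rewrite /ev !ffunE. Qed.
Lemma evM X (u v : eqfun X) x : ev (u * v) x = ev u x * ev v x.
Proof. by rewrite /ev ffunE. Qed.

Lemma eqfun_exists X (F : X -> S) :
  (forall x g, g \in D -> F (gset_act X x g) = sigma g (F x)) ->
  {psi : eqfun X | ev psi =1 F}.
Proof.
move=> FP; have Feq : [ffun x => F x] \in @equivariant X.
  by apply/equivariantP => x g gD; rewrite !ffunE FP.
by exists (EqFun Feq) => x; rewrite /ev ffunE.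
Qed.
Definition mkeqfun X (F : X -> S) FP : eqfun X := sval (@eqfun_exists X F FP).
Lemma ev_mk X (F : X -> S) FP : ev (@mkeqfun X F FP) =1 F.
Proof. exact: (svalP (eqfun_exists FP)). Qed.

Section Maps.
Variables (X Y : gset gT) (f : gmap X Y).

Lemma eqfun_res_subproof (psi : eqfun Y) x g : g \in D ->
  ev psi (f (gset_act X x g)) = sigma g (ev psi (f x)).
Proof. by move=> gD; rewrite gmapP ev_act. Qed.
Definition eqfun_res psi := mkeqfun (eqfun_res_subproof psi).

Lemma eqfun_tr_subproof (psi : eqfun X) y g : g \in D ->
  \sum_(x | f x == gset_act Y y g) ev psi x = sigma g (\sum_(x | f x == y) ev psi x).
Proof.
move=> gD; rewrite fibre_act rmorph_sum.
by apply: eq_bigr => x _; rewrite ev_act.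
Qed.
Definition eqfun_tr psi := mkeqfun (eqfun_tr_subproof psi).

Lemma eqfun_nm_subproof (psi : eqfun X) y g : g \in D ->
  \prod_(x | f x == gset_act Y y g) ev psi x = sigma g (\prod_(x | f x == y) ev psi x).
Proof.
move=> gD; rewrite fibre_act rmorph_prod.
by apply: eq_bigr => x _; rewrite ev_act.
Qed.
Definition eqfun_nm psi := mkeqfun (eqfun_nm_subproof psi).

Lemma eqfun_res_is_zmod_morphism : zmod_morphism eqfun_res.
Proof. by move=> u v; apply: ev_ext => x; rewrite evB !ev_mk evB. Qed.
Lemma eqfun_res_is_monoid_morphism : monoid_morphism eqfun_res.
Proof.
by split=> [|u v]; apply: ev_ext => x; rewrite ?ev1 ?evM !ev_mk ?ev1 ?evM.
Qed.
HB.instance Definition _ :=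
  GRing.isZmodMorphism.Build _ _ eqfun_res eqfun_res_is_zmod_morphism.
HB.instance Definition _ :=
  GRing.isMonoidMorphism.Build _ _ eqfun_res eqfun_res_is_monoid_morphism.
End Maps.

Lemma eqfun_mackey : @mackey_law gT (fun X => eqfun X : zmodType) eqfun_res eqfun_tr.
Proof.
split.
- exact: eqfun_res_is_zmod_morphism.
- move=> X Y f a b; apply: ev_ext => y; rewrite evB !ev_mk -sumrB.
  by apply: eq_bigr => x _; rewrite evB.
- by move=> X a; apply: ev_ext => x; rewrite ev_mk.
- by move=> X a; apply: ev_ext => x; rewrite ev_mk fibre_id.
- by move=> X Y Z g f a; apply: ev_ext => x; rewrite !ev_mk.
- move=> X Y Z g f a; apply: ev_ext => z; rewrite !ev_mk fibre_comp.
  by apply: eq_bigr => y _; rewrite ev_mk.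
- move=> W X Y Z p1 p2 f g pb a; apply: ev_ext => y; rewrite !ev_mk (fibre_base_change _ pb).
  by apply: eq_bigr => w _; rewrite ev_mk.
- by move=> X X0 a; apply: ev_ext => x; case: (fintype0 x X0).
move=> X Y Z i j cop a b; have [ii ij dij cij] := cop.
have [c ci cj] := coproduct_glue cop (ev a) (ev b).
have cD z g : g \in D -> c (gset_act Z z g) = sigma g (c z).
  move=> gD; have [[x <-]|[y <-]] := cij z.
    by rewrite -gmapP !ci ev_act.
  by rewrite -gmapP !cj ev_act.
exists (mkeqfun cD); split.
  by split; apply: ev_ext => z; rewrite !ev_mk ?ci ?cj.
move=> d [da db]; apply: ev_ext => z; rewrite ev_mk.
by have [[x <-]|[y <-]] := cij z; rewrite ?ci ?cj -?da -?db ev_mk.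
Qed.

Lemma eqfun_frobenius X Y (f : gmap X Y) a b :
  eqfun_tr f (eqfun_res f a * b) = a * eqfun_tr f b.
Proof.
apply: ev_ext => y; rewrite evM !ev_mk mulr_sumr.
by apply: eq_bigr => x /eqP <-; rewrite evM ev_mk.
Qed.

Definition eqfun_green : green gT :=
  @Green gT (fun X => eqfun X) (fun X Y f => eqfun_res f) eqfun_tr
    eqfun_mackey eqfun_frobenius.

(** All axioms hold pointwise, the exponential one by [fibre_exponential]. The proof is transparent
    so that [ev_res], [ev_tr] and [ev_nm] hold by unfolding. *)
Definition eqfun_tambara : tambara gT.
Proof.
apply: (@Tambara gT eqfun_green eqfun_nm).
- move=> X Y f; apply: ev_ext => y; rewrite ev1 ev_mk.
  by apply: big1 => x _; rewrite ev1.
- move=> X Y f a b; apply: ev_ext => y; rewrite evM !ev_mk -big_split.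
  by apply: eq_bigr => x _; rewrite evM.
- by move=> X a; apply: ev_ext => x; rewrite ev_mk fibre_id.
- move=> X Y Z g f a; apply: ev_ext => z; rewrite !ev_mk fibre_comp.
  by apply: eq_bigr => y _; rewrite ev_mk.
- move=> W X Y Z p1 p2 f g pb a; apply: ev_ext => y; rewrite !ev_mk (fibre_base_change _ pb).
  by apply: eq_bigr => w _; rewrite ev_mk.
move=> A X Y E P p f e f' q ex a; apply: ev_ext => y; rewrite !ev_mk.
under eq_bigr do rewrite ev_mk.
rewrite (fibre_exponential ex); apply: eq_bigr => z _; rewrite ev_mk.
by apply: eq_bigr => w _; rewrite ev_mk.
Defined.

End FunTambara.

(** * Coinduction from the trivial group *)

Section Adjunction.
Context (gT : finGroupType) (S : comPzRingType) (D : {set gT})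
  (sigma : gT -> {rmorphism S -> S}).
Implicit Types X Y : gset gT.
Local Notation T := (eqfun_tambara D sigma).

Lemma ev_res X Y (f : gmap X Y) (psi : T Y) x : ev (gres T f psi) x = ev psi (f x).
Proof. exact: ev_mk. Qed.
Lemma ev_tr X Y (f : gmap X Y) (psi : T X) y :
  ev (gtr T f psi) y = \sum_(x | f x == y) ev psi x.
Proof. exact: ev_mk. Qed.
Lemma ev_nm X Y (f : gmap X Y) (psi : T X) y :
  ev (gnm T f psi) y = \prod_(x | f x == y) ev psi x.
Proof. exact: ev_mk. Qed.

Definition ev_at X (x : X) (psi : T X) : S := ev psi x.
Lemma ev_at_is_zmod_morphism X (x : X) : zmod_morphism (ev_at x).
Proof. by move=> u v; apply: evB. Qed.
Lemma ev_at_is_monoid_morphism X (x : X) : monoid_morphism (ev_at x).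
Proof. by split=> [|u v]; [apply: ev1 | apply: evM]. Qed.
HB.instance Definition _ X (x : X) :=
  GRing.isZmodMorphism.Build _ _ (ev_at x) (ev_at_is_zmod_morphism x).
HB.instance Definition _ X (x : X) :=
  GRing.isMonoidMorphism.Build _ _ (ev_at x) (ev_at_is_monoid_morphism x).

(** * Adjuncts of ring maps out of level G/e *)

Section Transpose.
Variables (R : tambara gT) (phi : {rmorphism R G1 -> S}).
Hypothesis phi_sigma : forall g a, g \in D ->
  phi (gres R (orb (gel g)) a) = sigma g (phi a).

Lemma transpose_subproof X (a : R X) x g : g \in D ->
  phi (gres R (orb (gset_act X x g)) a) = sigma g (phi (gres R (orb x) a)).
Proof.
by move=> gD; rewrite -gcomp_orb_gel (mackey_res_comp (green_mackey R)) phi_sigma.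
Qed.
Definition transpose_fun X (a : R X) : T X := mkeqfun (transpose_subproof a).
Lemma ev_transpose_fun X (a : R X) x : ev (transpose_fun a) x = phi (gres R (orb x) a).
Proof. exact: ev_mk. Qed.
Lemma transpose_is_zmod_morphism X : zmod_morphism (@transpose_fun X).
Proof. by move=> u v; apply: ev_ext => x; rewrite evB !ev_transpose_fun !rmorphB. Qed.
Lemma transpose_is_monoid_morphism X : monoid_morphism (@transpose_fun X).
Proof.
by split=> [|u v]; apply: ev_ext => x; rewrite ?evM ?ev1 !ev_transpose_fun ?rmorph1 ?rmorphM.
Qed.
HB.instance Definition _ X :=
  GRing.isZmodMorphism.Build _ _ (@transpose_fun X) (@transpose_is_zmod_morphism X).
HB.instance Definition _ X :=
  GRing.isMonoidMorphism.Build _ _ (@transpose_fun X) (@transpose_is_monoid_morphism X).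

(** Transfers and norms are respected because restriction to a point turns them into sums and
    products over the fibre. *)
Definition transpose : tmor R T.
Proof.
apply: (@TMor gT R T (fun X => @transpose_fun X)) => X Y f a; apply: ev_ext => y.
- by rewrite ev_res !ev_transpose_fun -(mackey_res_comp (green_mackey R)) gcomp_orb.
- rewrite ev_tr ev_transpose_fun (mackey_res_orb_tr (green_mackey R)) rmorph_sum.
  by apply: eq_bigr => x _; rewrite ev_transpose_fun.
- rewrite ev_nm ev_transpose_fun res_orb_nm rmorph_prod.
  by apply: eq_bigr => x _; rewrite ev_transpose_fun.
Defined.
Lemma ev_transpose X (a : R X) x : ev (transpose X a) x = phi (gres R (orb x) a).
Proof. exact: ev_mk. Qed.

End Transpose.

End Adjunction.

(** * Finite presentation of the underlying algebra *)

Section Coinduction.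
Context (gT : finGroupType) (k : tambara gT).
Implicit Types (X Y : gset gT) (R : talg k) (B : calg (k G1)).

Definition coind_tambara (S : comPzRingType) : tambara gT :=
  @eqfun_tambara gT S set0 (fun _ => idfun).

Lemma coind_equivariant (S : comPzRingType) (R : tambara gT)
  (phi : {rmorphism R G1 -> S}) g a :
  g \in (set0 : {set gT}) -> phi (gres R (orb (gel g)) a) = idfun (phi a).
Proof. by rewrite inE. Qed.

Definition coind_tmor (S : comPzRingType) (R : tambara gT) (phi : {rmorphism R G1 -> S}) :
  tmor R (coind_tambara S) := transpose (@coind_equivariant S R phi).

Lemma ev_coind_tmor (S : comPzRingType) (R : tambara gT)
  (phi : {rmorphism R G1 -> S}) X (a : R X) x :
  ev (coind_tmor phi X a) x = phi (gres R (orb x) a).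
Proof. exact: ev_transpose. Qed.

Definition coind B : talg k := TAlg (coind_tmor (calg_str B)).

Lemma coind_amor_subproof R B (phi : cmor (underlying_calg R) B) X a :
  coind_tmor phi X (talg_str R X a) = talg_str (coind B) X a.
Proof.
apply: ev_ext => x; rewrite ev_coind_tmor [RHS]ev_coind_tmor -tmor_res.
exact: (cmor_str phi (gres k (orb x) a)).
Qed.
(** One direction of the adjunction between evaluation at G/e and [coind]; the other, [coind_cmor],
    evaluates functions at the base point. *)
Definition coind_amor R B (phi : cmor (underlying_calg R) B) : amor R (coind B) :=
  @AMor gT k R (coind B) (coind_tmor (phi : {rmorphism R G1 -> B})) (coind_amor_subproof phi).

Lemma coind_cmor_subproof R B (h : amor R (coind B)) a :
  (ev_at (gel 1%g) \o h G1) (calg_str (underlying_calg R) a) = calg_str B a.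
Proof.
change (ev (h G1 (talg_str R G1 a)) (gel 1%g) = calg_str B a).
rewrite amor_str [LHS]ev_coind_tmor orb1.
by rewrite (mackey_res_id (green_mackey k)).
Qed.
Definition coind_cmor R B (h : amor R (coind B)) : cmor (underlying_calg R) B :=
  @CMor _ (underlying_calg R) B (ev_at (gel 1%g) \o h G1) (coind_cmor_subproof h).

Lemma coind_cmorE R B (h : amor R (coind B)) a : coind_cmor h a = ev (h G1 a) (gel 1%g).
Proof. by []. Qed.

Lemma coind_amorE R B (phi : cmor (underlying_calg R) B) a :
  ev (coind_amor phi G1 a) (gel 1%g) = phi a.
Proof. by rewrite [LHS]ev_coind_tmor orb1 (mackey_res_id (green_mackey R)). Qed.

Definition underlying_cmor R1 R2 (u : amor R1 R2) :
  cmor (underlying_calg R1) (underlying_calg R2) :=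
  @CMor _ (underlying_calg R1) (underlying_calg R2) (u G1) (@amor_str _ _ _ _ u G1).

(** By adjunction, maps from F(G/e) to B are families of functions [L i] -> B. Hence a generator in
    level [L i] becomes one polynomial variable for each point of [L i]. *)
Lemma free_underlying n (L : 'I_n -> gset gT) (F : talg k) (x : forall i, F (L i)) :
  is_free_talg x ->
  is_free_calg (fun j : 'I_(#|{: {i : 'I_n & L i}}|) => let t := enum_val j in
    gres F (orb (tagged t)) (x (tag t)) : underlying_calg F).
Proof.
move=> Ffree B b.
have rP (i : 'I_n) : {r : coind B (L i) |
    forall z, ev r z = b (enum_rank (Tagged (fun i => L i : Type) z))}.
  by apply: eqfun_exists => z g; rewrite inE.
have [h [hx hU]] := Ffree (coind B) (fun i => sval (rP i)).
exists (coind_cmor h); split=> [j|h' h'x a].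
  rewrite coind_cmorE tmor_res ev_res orb_gel1 hx (svalP (rP _)).
  by congr b; apply: enum_val_inj; rewrite enum_rankK; case: (enum_val j).
rewrite coind_cmorE -(hU (coind_amor h')) ?coind_amorE // => i.
apply: ev_ext => z; rewrite [LHS]ev_coind_tmor (svalP (rP i)) -h'x.
by rewrite enum_rankK.
Qed.

(** Left adjoints preserve coequalizers: transpose to [coind C], factor there, transpose back. *)
Lemma coequalizer_underlying F1 F0 R (u v : amor F1 F0) (q : amor F0 R) :
  is_coequalizer u v q ->
  is_ccoequalizer (underlying_cmor u) (underlying_cmor v) (underlying_cmor q).
Proof.
case=> quv qU; split=> [a|C h huv]; first exact: quv.
have [|hq [hqq hqU]] := qU (coind C) (coind_amor h).
  move=> X a; apply: ev_ext => x; rewrite !ev_coind_tmor -!tmor_res.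
  exact: huv.
exists (coind_cmor hq); split=> [a|h' h'q a].
  by rewrite coind_cmorE hqq coind_amorE.
rewrite coind_cmorE -(hqU (coind_amor h')) ?coind_amorE // => X b.
apply: ev_ext => x; rewrite [LHS]ev_coind_tmor [RHS]ev_coind_tmor -tmor_res.
exact: h'q.
Qed.

Lemma finitely_presented_underlying R :
  finitely_presented R -> ring_finitely_presented (underlying_calg R).
Proof.
case=> n1 [n0 [L1 [L0 [F1 [F0 [x1 [x0 [u [v [q [f1 f0 c]]]]]]]]]]].
do 9!eexists; split.
- exact: (free_underlying f1).
- exact: (free_underlying f0).
exact: (coequalizer_underlying c).
Qed.

End Coinduction.

(** * Induction from the trivial group *)

Section Induction.
Context (gT : finGroupType) (k : green gT).
Implicit Types X Y Z : gset gT.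

Section Module.
Variable N : lmodType (k G1).

(** A fresh name for the function group, so that it can be a module over k(X), acting at x through
    restriction along x, instead of over k(G/e). *)
Definition indfun X : Type := {ffun X -> N}.
HB.instance Definition _ X := GRing.Zmodule.on (indfun X).

Definition ind_scale X (c : k X) (psi : indfun X) : indfun X :=
  [ffun x => gres k (orb x) c *: psi x].
Lemma ind_scaleA X (a b : k X) (v : indfun X) :
  ind_scale a (ind_scale b v) = ind_scale (a * b) v.
Proof. by apply/ffunP => x; rewrite !ffunE rmorphM scalerA. Qed.
Lemma ind_scale1 X : left_id 1 (@ind_scale X).
Proof. by move=> v; apply/ffunP => x; rewrite ffunE rmorph1 scale1r. Qed.
Lemma ind_scaleDr X : right_distributive (@ind_scale X) +%R.
Proof. by move=> a u v; apply/ffunP => x; rewrite !ffunE scalerDr. Qed.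
Lemma ind_scaleDl X (v : indfun X) : {morph (@ind_scale X)^~ v : a b / a + b}.
Proof. by move=> a b; apply/ffunP => x; rewrite !ffunE rmorphD scalerDl. Qed.
HB.instance Definition _ X := GRing.Zmodule_isLmodule.Build (k X) (indfun X)
  (@ind_scaleA X) (@ind_scale1 X) (@ind_scaleDr X) (@ind_scaleDl X).

Definition ind_res X Y (f : gmap X Y) (psi : indfun Y) : indfun X :=
  [ffun x => psi (f x)].
Definition ind_tr X Y (f : gmap X Y) (psi : indfun X) : indfun Y :=
  [ffun y => \sum_(x | f x == y) psi x].

Lemma ind_mackey : @mackey_law gT (fun X => indfun X : lmodType (k X)) ind_res ind_tr.
Proof.
split.
- by move=> X Y f a b; apply/ffunP => x; rewrite !ffunE.
- move=> X Y f a b; apply/ffunP => y; rewrite !ffunE -sumrB.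
  by apply: eq_bigr => x _; rewrite !ffunE.
- by move=> X a; apply/ffunP => x; rewrite ffunE.
- by move=> X a; apply/ffunP => x; rewrite ffunE fibre_id.
- by move=> X Y Z g f a; apply/ffunP => x; rewrite !ffunE.
- move=> X Y Z g f a; apply/ffunP => z; rewrite !ffunE fibre_comp.
  by apply: eq_bigr => y _; rewrite ffunE.
- move=> W X Y Z p1 p2 f g pb a; apply/ffunP => y; rewrite !ffunE (fibre_base_change _ pb).
  by apply: eq_bigr => w _; rewrite ffunE.
- by move=> X X0 a; apply/ffunP => x; case: (fintype0 x X0).
move=> X Y Z i j cop a b; have [ii ij dij cij] := cop.
have [c ci cj] := coproduct_glue cop (a : indfun X) (b : indfun Y).
exists [ffun z => c z]; split.
  by split; apply/ffunP => z; rewrite !ffunE ?ci ?cj.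
move=> d [da db]; apply/ffunP => z; rewrite ffunE.
by have [[x <-]|[y <-]] := cij z; rewrite ?ci ?cj -?da -?db ffunE.
Qed.

Definition ind : kmod k.
Proof.
apply: (@KMod gT k (fun X => indfun X) ind_res ind_tr ind_mackey) => X Y f a m;
  apply/ffunP => x; rewrite !ffunE.
- by rewrite -(mackey_res_comp (green_mackey k)) gcomp_orb.
- rewrite scaler_sumr; apply: eq_bigr => z /eqP <-.
  by rewrite ffunE -(mackey_res_comp (green_mackey k)) gcomp_orb.
- rewrite (mackey_res_orb_tr (green_mackey k)) scaler_suml.
  by apply: eq_bigr => z /eqP <-; rewrite !ffunE.
Defined.

Definition delta X (x : X) (n : N) : ind X := [ffun y => if y == x then n else 0] : indfun X.

(** The base point lies in the fibre of [orb x] over y only for y = x. So point masses come from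
    G/e, and they generate [ind] under transfer. *)
Lemma tr_delta X (x : X) n : ktr ind (orb x) (delta (gel 1%g) n) = delta x n.
Proof.
apply/ffunP => y; rewrite [LHS]ffunE [RHS]ffunE.
under eq_bigr do rewrite ffunE.
rewrite -big_mkcondr; case: eqVneq => [->|yx].
  rewrite (big_pred1 (gel 1%g)) // => a.
  rewrite /= andbC; case: eqVneq => [->|//].
  by rewrite gelK act1 eqxx.
rewrite big1 // => a /andP[/eqP ay /eqP a1].
by move: ay yx; rewrite a1 orb_gel1 => ->; rewrite eqxx.
Qed.

Lemma ind_decomp X (psi : ind X) :
  psi = \sum_x ktr ind (orb x) (delta (gel 1%g) ((psi : indfun X) x)).
Proof.
under eq_bigr do rewrite tr_delta.
apply/ffunP => y; rewrite sum_ffunE (bigD1 y) //= ffunE eqxx big1 ?addr0 // => x xy.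
by rewrite ffunE eq_sym (negPf xy).
Qed.

Lemma ind_ext (Q : kmod k) (h h' : kmor ind Q) :
  (forall n, h G1 (delta (gel 1%g) n) = h' G1 (delta (gel 1%g) n)) ->
  forall X psi, h X psi = h' X psi.
Proof.
move=> hh' X psi; rewrite [psi]ind_decomp !linear_sum.
by apply: eq_bigr => x _; rewrite !kmor_tr hh'.
Qed.

Section Lift.
Variables (Q : kmod k) (h : {linear N -> Q G1}).
(** The adjunct exhibiting [ind] as left adjoint to evaluation at G/e: a mass at x is sent through h
    and transferred along [orb x]. *)
Definition ind_lift_fun X (psi : ind X) : Q X :=
  \sum_x ktr Q (orb x) (h ((psi : indfun X) x)).
Lemma ind_lift_linear X : linear (@ind_lift_fun X).
Proof.
move=> a u v; rewrite /ind_lift_fun scaler_sumr -big_split; apply: eq_bigr => x _ /=.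
by rewrite !ffunE linearP (mackey_trD (kmod_mackey Q)) ktr_frobeniusl.
Qed.
HB.instance Definition _ X :=
  GRing.isLinear.Build _ _ _ _ (@ind_lift_fun X) (@ind_lift_linear X).
Definition ind_lift : kmor ind Q.
Proof.
apply: (@KMor gT k ind Q (fun X => @ind_lift_fun X)) => X Y f m; rewrite /= /ind_lift_fun.
- rewrite (mackey_res_sum (kmod_mackey Q)) (partition_big f predT) //=.
  apply: eq_bigr => y _; rewrite (mackey_res_tr_orb (kmod_mackey Q)).
  by apply: eq_bigr => x /eqP <-; rewrite ffunE.
- rewrite (mackey_tr_sum (kmod_mackey Q)) (partition_big f predT) //=.
  apply: eq_bigr => y _; rewrite ffunE linear_sum (mackey_tr_sum (kmod_mackey Q)).
  by apply: eq_bigr => x /eqP <-; rewrite -(mackey_tr_comp (kmod_mackey Q)) gcomp_orb.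
Defined.
Lemma ind_liftE X (psi : ind X) :
  ind_lift X psi = \sum_x ktr Q (orb x) (h ((psi : indfun X) x)).
Proof. by []. Qed.
End Lift.

Section Colift.
Variables (M : kmod k) (h : {linear M G1 -> N}).
(** The adjunct exhibiting [ind] as right adjoint to evaluation at G/e as well. *)
Definition ind_colift_fun X (m : M X) : ind X := [ffun x => h (kres M (orb x) m)] : indfun X.
Lemma ind_colift_linear X : linear (@ind_colift_fun X).
Proof.
move=> a u v; apply/ffunP => x; rewrite !ffunE.
by rewrite (mackey_resD (kmod_mackey M)) kresZ linearP.
Qed.
HB.instance Definition _ X :=
  GRing.isLinear.Build _ _ _ _ (@ind_colift_fun X) (@ind_colift_linear X).
Definition ind_colift : kmor M ind.
Proof.
apply: (@KMor gT k M ind (fun X => @ind_colift_fun X)) => X Y f m;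
  apply/ffunP => y; rewrite !ffunE.
- by rewrite -(mackey_res_comp (kmod_mackey M)) gcomp_orb.
- rewrite (mackey_res_orb_tr (kmod_mackey M)) linear_sum.
  by apply: eq_bigr => x _; rewrite ffunE.
Defined.
Lemma ind_coliftE X (m : M X) x :
  (ind_colift X m : indfun X) x = h (kres M (orb x) m).
Proof. exact: ffunE. Qed.
End Colift.

End Module.
End Induction.

(** * Flatness *)

Section Bilinear.
Context (A : comPzRingType) (M N P : lmodType A) (t : M -> N -> P).
Hypothesis tP : bilinear_map t.

Lemma bilinearDl n a b : t (a + b) n = t a n + t b n.
Proof. by have := bilinear_linl tP n 1 a b; rewrite !scale1r. Qed.
Lemma bilinearDr m a b : t m (a + b) = t m a + t m b.
Proof. by have := bilinear_linr tP m 1 a b; rewrite !scale1r. Qed.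
Lemma bilinear0l n : t 0 n = 0.
Proof. by apply: (addrI (t 0 n)); rewrite -bilinearDl !addr0. Qed.
Lemma bilinear0r m : t m 0 = 0.
Proof. by apply: (addrI (t m 0)); rewrite -bilinearDr !addr0. Qed.
Lemma bilinear_suml (I : Type) (r : seq I) (Q : pred I) F n :
  t (\sum_(i <- r | Q i) F i) n = \sum_(i <- r | Q i) t (F i) n.
Proof. exact: (big_morph (t^~ n) (bilinearDl n) (bilinear0l n)). Qed.
Lemma bilinear_sumr (I : Type) (r : seq I) (Q : pred I) F m :
  t m (\sum_(i <- r | Q i) F i) = \sum_(i <- r | Q i) t m (F i).
Proof. exact: (big_morph (t m) (bilinearDr m) (bilinear0r m)). Qed.

End Bilinear.

Lemma kpairing_bilinear (gT : finGroupType) (k : green gT) (M N P : kmod k)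
  (t : forall X, M X -> N X -> P X) X : kpairing t -> bilinear_map (t X).
Proof. by move=> tP; split=> *; rewrite ?(kpairing_linl tP) ?(kpairing_linr tP). Qed.

Section Flatness.
Context (gT : finGroupType) (k : green gT).
Implicit Types (X Y : gset gT) (M N P Q : kmod k) (V W : lmodType (k G1)).

Lemma gres_orb1 (a : k G1) : gres k (orb (gel 1%g)) a = a.
Proof. by rewrite orb1 (mackey_res_id (green_mackey k)). Qed.
Lemma kres_orb1 M (a : M G1) : kres M (orb (gel 1%g)) a = a.
Proof. by rewrite orb1 (mackey_res_id (kmod_mackey M)). Qed.

Definition ind_ev V (psi : ind V G1) : V := (psi : indfun V G1) (gel 1%g).
Lemma ind_ev_linear V : linear (@ind_ev V).
Proof. by move=> a u v; rewrite /ind_ev !ffunE gres_orb1. Qed.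
HB.instance Definition _ V :=
  GRing.isLinear.Build _ _ _ _ (@ind_ev V) (@ind_ev_linear V).

Definition delta1 V (v : V) : ind V G1 := delta (gel 1%g) v.
Lemma delta1_linear V : linear (@delta1 V).
Proof.
move=> a u v; apply/ffunP => x; rewrite !ffunE.
by case: eqVneq => [->|_]; rewrite ?gres_orb1 // scaler0 addr0.
Qed.
HB.instance Definition _ V :=
  GRing.isLinear.Build _ _ _ _ (@delta1 V) (@delta1_linear V).

Lemma ind_ev_delta1 V (v : V) : ind_ev (delta1 v) = v.
Proof. by rewrite /ind_ev ffunE eqxx. Qed.

Lemma ind_ev_res V X (x : X) (psi : ind V X) :
  ind_ev (kres (ind V) (orb x) psi) = (psi : indfun V X) x.
Proof. by rewrite /ind_ev ffunE orb_gel1. Qed.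

Definition ind_map V W (f : {linear V -> W}) : kmor (ind V) (ind W) :=
  ind_colift (f \o @ind_ev V).
Lemma ind_mapE V W (f : {linear V -> W}) X psi x :
  (ind_map f X psi : indfun W X) x = f ((psi : indfun V X) x).
Proof. by rewrite ind_coliftE /= ind_ev_res. Qed.

Lemma ind_map_delta1 V W (f : {linear V -> W}) v : ind_map f G1 (delta1 v) = delta1 (f v).
Proof.
apply/ffunP => x; rewrite ind_mapE !ffunE.
by case: eqP => // _; rewrite linear0.
Qed.

(** Forwards, exactness is pointwise. Backwards, V is naturally a retract of level G/e of [ind V],
    through [delta1] and [ind_ev]. *)
Lemma ind_exact V1 V2 V3 (f : {linear V1 -> V2}) (g : {linear V2 -> V3}) :
  short_exact f g <-> kshort_exact (ind_map f) (ind_map g).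
Proof.
split=> [[fI fg gS] X|h].
  split=> [u v uv|b|c].
  - by apply/ffunP => x; apply: fI; rewrite -!ind_mapE uv.
  - split=> [gb|[a <-]]; last first.
      by apply/ffunP => x; rewrite !ind_mapE ffunE; apply/fg; exists ((a : indfun V1 X) x).
    have aP x : exists a, f a = (b : indfun V2 X) x.
      by apply/fg; rewrite -ind_mapE gb ffunE.
    have [a aE] := choice aP.
    by exists ([ffun x => a x] : indfun V1 X); apply/ffunP => x; rewrite ind_mapE ffunE.
  have [b bE] := choice (fun x => gS ((c : indfun V3 X) x)).
  by exists ([ffun x => b x] : indfun V2 X); apply/ffunP => x; rewrite ind_mapE ffunE.
have [fI fg gS] := h G1; split=> [u v uv|b|c].
- rewrite -[u]ind_ev_delta1 -[v]ind_ev_delta1; congr ind_ev.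
  by apply: fI; rewrite !ind_map_delta1 uv.
- split=> [gb|[a <-]]; last first.
    have /fg : exists a', ind_map f G1 a' = ind_map f G1 (delta1 a) by eexists.
    rewrite !ind_map_delta1 => /(congr1 (@ind_ev V3)).
    by rewrite ind_ev_delta1 => ->; rewrite linear0.
  have [a aE] : exists a, ind_map f G1 a = delta1 b.
    by apply/fg; rewrite ind_map_delta1 gb linear0.
  exists (ind_ev a); apply: etrans (ind_ev_delta1 b); rewrite -aE /ind_ev.
  by rewrite ind_mapE.
have [b bE] := gS (delta1 c).
by exists (ind_ev b); apply: etrans (ind_ev_delta1 c); rewrite -bE /ind_ev ind_mapE.
Qed.

(** Bilinear maps at G/e with values in V are the same as pairings with values in [ind V], by right
    adjointness. The universal property of the box product is applied to these. *)
Lemma box_tensor M N P (t : forall X, M X -> N X -> P X) :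
  is_box t -> is_tensor (t G1).
Proof.
case=> tP tU; split=> [|V s sP].
  exact: kpairing_bilinear.
pose s' X (m : M X) (n : N X) : ind V X :=
  [ffun x => s (kres M (orb x) m) (kres N (orb x) n)] : indfun V X.
have s'P : kpairing s'.
  split.
  - move=> X n a m m'; apply/ffunP => x; rewrite !ffunE.
    by rewrite (mackey_resD (kmod_mackey M)) kresZ (bilinear_linl sP).
  - move=> X m a n n'; apply/ffunP => x; rewrite !ffunE.
    by rewrite (mackey_resD (kmod_mackey N)) kresZ (bilinear_linr sP).
  - move=> X Y f m n; apply/ffunP => x; rewrite !ffunE.
    by rewrite -(mackey_res_comp (kmod_mackey M)) -(mackey_res_comp (kmod_mackey N)) gcomp_orb.
  - move=> X Y f m n; apply/ffunP => y; rewrite !ffunE.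
    rewrite (mackey_res_orb_tr (kmod_mackey M)) (bilinear_suml sP).
    by apply: eq_bigr => x /eqP <-; rewrite ffunE -(mackey_res_comp (kmod_mackey N)) gcomp_orb.
  - move=> X Y f m n; apply/ffunP => y; rewrite !ffunE.
    rewrite (mackey_res_orb_tr (kmod_mackey N)) (bilinear_sumr sP).
    by apply: eq_bigr => x /eqP <-; rewrite ffunE -(mackey_res_comp (kmod_mackey M)) gcomp_orb.
have [h [hE hU]] := tU _ _ s'P.
exists (@ind_ev V \o h G1); split=> [m n|h' h'E p] /=.
  by rewrite hE /ind_ev ffunE !kres_orb1.
rewrite -(hU (ind_colift h')) ?/ind_ev ?ind_coliftE ?kres_orb1 // => X m n.
apply/ffunP => x; rewrite ind_coliftE ffunE.
by rewrite (kpairing_res tP) h'E.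
Qed.

(** The projection formula for induction. As [ind V] is generated by transfers from G/e, a pairing
    on it is determined by its values on m and [delta1 v]. *)
Lemma ind_box M V W (t : M G1 -> V -> W) : is_tensor t ->
  @is_box gT k M (ind V) (ind W) (fun X m psi =>
    [ffun x => t (kres M (orb x) m) ((psi : indfun V X) x)] : indfun W X).
Proof.
case=> tP tU.
split=> [|Q s sP].
  split.
  - move=> X n a m m'; apply/ffunP => x; rewrite !ffunE.
    by rewrite (mackey_resD (kmod_mackey M)) kresZ (bilinear_linl tP).
  - move=> X m a n n'; apply/ffunP => x; rewrite !ffunE.
    by rewrite (bilinear_linr tP).
  - move=> X Y f m n; apply/ffunP => x; rewrite !ffunE.
    by rewrite -(mackey_res_comp (kmod_mackey M)) gcomp_orb.
  - move=> X Y f m n; apply/ffunP => y; rewrite !ffunE.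
    rewrite (mackey_res_orb_tr (kmod_mackey M)) (bilinear_suml tP).
    by apply: eq_bigr => x /eqP <-; rewrite !ffunE.
  - move=> X Y f m n; apply/ffunP => y; rewrite !ffunE.
    rewrite (bilinear_sumr tP).
    by apply: eq_bigr => x /eqP <-; rewrite !ffunE -(mackey_res_comp (kmod_mackey M)) gcomp_orb.
have s1P : bilinear_map (fun m v => s G1 m (delta1 v)).
  split=> [n a m m'|m a n n']; first by rewrite (kpairing_linl sP).
  by rewrite linearP (kpairing_linr sP).
have [h [hE hU]] := tU _ _ s1P.
have lift_t X m psi : ind_lift h X ([ffun x =>
    t (kres M (orb x) m) ((psi : indfun V X) x)] : indfun W X) = s X m psi.
  rewrite ind_liftE [in RHS](ind_decomp psi) (bilinear_sumr (kpairing_bilinear X sP)).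
  apply: eq_bigr => x _; rewrite ffunE hE.
  by rewrite (kpairing_trr sP).
exists (ind_lift h); split=> // h' h'E; apply: ind_ext => w.
(* The mass t m v at the base point is the pairing of m with [delta1 v], so uniqueness for the
   tensor product identifies both lifts on base point masses. *)
have tE m v : (h' G1 \o @delta1 W) (t m v) = s G1 m (delta1 v).
  rewrite -h'E; congr (h' G1 _); apply/ffunP => x; rewrite !ffunE.
  by case: eqVneq => [->|_]; rewrite ?kres_orb1 ?(bilinear0r tP).
have tE' m v : (ind_lift h G1 \o @delta1 W) (t m v) = s G1 m (delta1 v).
  rewrite -lift_t; congr (ind_lift h G1 _); apply/ffunP => x; rewrite !ffunE.
  by case: eqVneq => [->|_]; rewrite ?kres_orb1 ?(bilinear0r tP).
have := hU _ tE w; have := hU _ tE' w; by move=> /= -> ->.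
Qed.

(** The sequence is induced up, boxed with M by the projection formula, and its exactness is read
    back with [ind_exact]. *)
Lemma flat_underlying M : kflat M -> flat_module (M G1).
Proof.
move=> Mflat V1 V2 V3 f g fg P1 P2 P3 t1 t2 t3 t1P t2P t3P f' g' f'E g'E.
apply/ind_exact; apply: (Mflat _ _ _ _ _ (iffLR (ind_exact f g) fg)
  _ _ _ _ _ _ (ind_box t1P) (ind_box t2P) (ind_box t3P)) => X m a.
- by apply/ffunP => x; rewrite ind_mapE ffunE f'E [RHS]ffunE ind_mapE.
- by apply/ffunP => x; rewrite ind_mapE ffunE g'E [RHS]ffunE ind_mapE.
Qed.

End Flatness.

(** * The diagonal ideal *)

Section Quotient.
Context (S : comPzRingType) (J : S -> Prop).
Hypotheses (J0 : J 0) (JD : forall a b, J a -> J b -> J (a + b))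
  (JM : forall a b, J b -> J (a * b)).

Let JB a b : J a -> J b -> J (a - b).
Proof. by move=> Ja Jb; apply: JD => //; rewrite -mulN1r; apply: JM. Qed.

(** A canonical representative of x + J: the choice depends only on the class, so the quotient can
    be the subtype of chosen representatives. *)
Definition quot_repr (x : S) : S := choose (fun y => `[< J (y - x) >]) x.

Lemma quot_reprP x : J (quot_repr x - x).
Proof.
apply/asboolP; apply: (@chooseP _ (fun y => `[< J (y - x) >]) x).
by apply/asboolP; rewrite subrr.
Qed.

Lemma quot_repr_eq x y : J (x - y) -> quot_repr x = quot_repr y.
Proof.
move=> Jxy; rewrite /quot_repr.
have /eq_choose -> : (fun z => `[< J (z - x) >]) =1 (fun z => `[< J (z - y) >]).
  move=> z; apply/asboolP/asboolP => Jz.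
    by rewrite -(subrKA x); apply: JD.
  by rewrite -(subrKA y) -[X in _ + X]opprB; apply: JB.
by apply: choose_id; apply/asboolP; rewrite ?subrr.
Qed.

Record quot := Quot { quot_val : S; _ : quot_repr quot_val == quot_val }.
HB.instance Definition _ := [isSub for quot_val].
HB.instance Definition _ := [Choice of quot by <:].

Lemma quot_repr_idem x : quot_repr (quot_repr x) == quot_repr x.
Proof. exact/eqP/quot_repr_eq/quot_reprP. Qed.
Definition quot_pi (x : S) : quot := Quot (quot_repr_idem x).

Lemma quot_piE x y : quot_pi x = quot_pi y <-> J (x - y).
Proof.
split=> [/(congr1 quot_val) /= e|Jxy]; last by apply: val_inj; apply: quot_repr_eq.
rewrite -(subrKA (quot_repr x)) -[X in X + _]opprB {2}e.
by rewrite addrC; apply: JB; apply: quot_reprP.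
Qed.
Lemma quot_piK (a : quot) : quot_pi (val a) = a.
Proof. by apply: val_inj; case: a => a ae; apply/eqP. Qed.

Definition quot_add (a b : quot) := quot_pi (val a + val b).
Definition quot_opp (a : quot) := quot_pi (- val a).
Definition quot_mul (a b : quot) := quot_pi (val a * val b).

Lemma quot_addE x y : quot_add (quot_pi x) (quot_pi y) = quot_pi (x + y).
Proof.
by apply/quot_piE; rewrite opprD addrACA; apply: JD; apply: quot_reprP.
Qed.
Lemma quot_oppE x : quot_opp (quot_pi x) = quot_pi (- x).
Proof.
by apply/quot_piE; rewrite /= -opprD -mulN1r; apply: JM; apply: quot_reprP.
Qed.
Lemma quot_mulE x y : quot_mul (quot_pi x) (quot_pi y) = quot_pi (x * y).
Proof.
apply/quot_piE; rewrite -(subrKA (quot_repr x * y)) -mulrBr -mulrBl.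
by apply: JD; [|rewrite mulrC]; apply: JM; apply: quot_reprP.
Qed.

Let quotW (Q : quot -> Prop) : (forall x, Q (quot_pi x)) -> forall a, Q a.
Proof. by move=> h a; rewrite -[a]quot_piK. Qed.

Lemma quot_addA : associative quot_add.
Proof. by do 3!elim/quotW=> ?; rewrite !quot_addE addrA. Qed.
Lemma quot_addC : commutative quot_add.
Proof. by do 2!elim/quotW=> ?; rewrite !quot_addE addrC. Qed.
Lemma quot_add0 : left_id (quot_pi 0) quot_add.
Proof. by elim/quotW=> ?; rewrite !quot_addE add0r. Qed.
Lemma quot_addN : left_inverse (quot_pi 0) quot_opp quot_add.
Proof. by elim/quotW=> ?; rewrite quot_oppE !quot_addE addNr. Qed.
HB.instance Definition _ :=
  GRing.isZmodule.Build quot quot_addA quot_addC quot_add0 quot_addN.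
Lemma quot_mulA : associative quot_mul.
Proof. by do 3!elim/quotW=> ?; rewrite !quot_mulE mulrA. Qed.
Lemma quot_mulC : commutative quot_mul.
Proof. by do 2!elim/quotW=> ?; rewrite !quot_mulE mulrC. Qed.
Lemma quot_mul1 : left_id (quot_pi 1) quot_mul.
Proof. by elim/quotW=> ?; rewrite !quot_mulE mul1r. Qed.
Lemma quot_mulD : left_distributive quot_mul quot_add.
Proof. by do 3!elim/quotW=> ?; rewrite !(quot_addE, quot_mulE) mulrDl. Qed.
HB.instance Definition _ :=
  GRing.Zmodule_isComPzRing.Build quot quot_mulA quot_mulC quot_mul1 quot_mulD.

Lemma quot_pi_is_zmod_morphism : zmod_morphism quot_pi.
Proof.
by move=> x y; rewrite -quot_addE -quot_oppE.
Qed.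
Lemma quot_pi_is_monoid_morphism : monoid_morphism quot_pi.
Proof. by split=> // x y; rewrite -quot_mulE. Qed.

Lemma quotient_ring : exists (Q : comPzRingType) (p : {rmorphism S -> Q}),
  forall x, p x = 0 <-> J x.
Proof.
pose p : {rmorphism S -> quot} := HB.pack_for {rmorphism S -> quot} quot_pi
  (GRing.isZmodMorphism.Build _ _ quot_pi quot_pi_is_zmod_morphism)
  (GRing.isMonoidMorphism.Build _ _ quot_pi quot_pi_is_monoid_morphism).
by exists quot, p => x; rewrite -{2}[x]subr0; apply: quot_piE.
Qed.

End Quotient.

(** Both maps factor the same bilinear map. They are plain functions with linearity proofs, so that
    composites with multiplications can be supplied directly. *)
Lemma tensor_ext (A : comPzRingType) (M N P : lmodType A) (t : M -> N -> P)
    (Q : lmodType A) (f g : P -> Q) : is_tensor t -> linear f -> linear g ->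
  (forall m n, f (t m n) = g (t m n)) -> f =1 g.
Proof.
case=> tP tU fL gL fg p.
have sP : bilinear_map (fun m n => f (t m n)).
  by split=> *; rewrite ?(bilinear_linl tP) ?(bilinear_linr tP) fL.
have [h [_ hU]] := tU Q _ sP.
pose F : {linear P -> Q} := HB.pack_for {linear P -> Q} f
  (GRing.isLinear.Build _ _ _ _ f fL).
pose G : {linear P -> Q} := HB.pack_for {linear P -> Q} g
  (GRing.isLinear.Build _ _ _ _ g gL).
by rewrite -[f p]/(F p) -[g p]/(G p) (hU F) // (hU G).
Qed.

(** * Tensor squares as pushouts of commutative rings *)

Section Pushout.
Context (A : comPzRingType) (B P : calg A) (i1 i2 : cmor B P).
Hypothesis iT : @is_tensor A (calg_mod B) (calg_mod B) (calg_mod P)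
  (fun a b : B => i1 a * i2 b).

Lemma pushout_exists (C : comPzRingType) (f1 f2 : {rmorphism B -> C}) :
  (forall c, f1 (calg_str B c) = f2 (calg_str B c)) ->
  exists h : {rmorphism P -> C}, forall a b, h (i1 a * i2 b) = f1 a * f2 b.
Proof.
move=> f12; pose Q : lmodType A := rscal (f1 \o calg_str B).
have QE (c : A) (q : Q) : c *: q = f1 (calg_str B c) * (q : C) by [].
have PE (c : A) (p : calg_mod P) : c *: p = calg_str P c * (p : P) by [].
have sP : @bilinear_map A (calg_mod B) (calg_mod B) Q (fun a b : B => f1 a * f2 b).
  split=> [n a m m'|m a n n'].
  - change (f1 (calg_str B a * m + m') * f2 n =
      f1 (calg_str B a) * (f1 m * f2 n) + f1 m' * f2 n).
    by rewrite rmorphD rmorphM mulrDl mulrA.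
  - change (f1 m * f2 (calg_str B a * n + n') =
      f1 (calg_str B a) * (f1 m * f2 n) + f1 m * f2 n').
    by rewrite rmorphD rmorphM -f12 mulrDr mulrCA.
have [h [hE _]] := iT.2 Q _ sP.
have h1 : h 1 = 1 :> C.
  have -> : (1 : P) = i1 1 * i2 1 by rewrite !rmorph1 mulr1.
  by rewrite hE !rmorph1 mulr1.
have mulL (q : C) : linear (fun p : Q => (p : C) * q : Q).
  by move=> a u v; rewrite !QE mulrDl mulrA.
have mulLP (q : P) : linear (fun p : calg_mod P => (p : P) * q : calg_mod P).
  by move=> a u v; rewrite !PE mulrDl mulrA.
(* Multiplicativity is proved one variable at a time: against a pure tensor first, then against any
   element. *)
have hM1 (p : P) c d : h (p * (i1 c * i2 d)) = (h p : C) * h (i1 c * i2 d) :> C.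
  apply: (tensor_ext iT (Q := Q) (f := fun p : calg_mod P => h ((p : P) * (i1 c * i2 d)) : Q)
    (g := fun p : calg_mod P => (h p : C) * h (i1 c * i2 d) : Q)).
  - by move=> a u v; rewrite mulLP linearP.
  - by move=> a u v; rewrite linearP mulL.
  - by move=> m n; rewrite mulrACA -!rmorphM !hE !rmorphM mulrACA.
have hM (p q : P) : h (p * q) = (h p : C) * h q :> C.
  rewrite mulrC [RHS]mulrC; apply: (tensor_ext iT (Q := Q)
    (f := fun q : calg_mod P => h ((q : P) * p) : Q)
    (g := fun q : calg_mod P => (h q : C) * h p : Q)).
  - by move=> a u v; rewrite mulLP linearP.
  - by move=> a u v; rewrite linearP mulL.
  - by move=> m n; rewrite mulrC hM1 mulrC.
have hZ : zmod_morphism (h : P -> C) by move=> u v; apply: raddfB.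
by exists (HB.pack_for {rmorphism P -> C} (h : P -> C)
  (GRing.isZmodMorphism.Build _ _ (h : P -> C) hZ)
  (GRing.isMonoidMorphism.Build _ _ (h : P -> C) (conj h1 hM))).
Qed.

Lemma pushout_ext (C : comPzRingType) (f g : {rmorphism P -> C}) :
  (forall a b, f (i1 a * i2 b) = g (i1 a * i2 b)) -> f =1 g.
Proof.
move=> fg; pose Q : lmodType A := rscal (f \o calg_str P).
(* Scalars are pure tensors, so g is also linear for the module structure that f puts on C. *)
have fgA c : g (calg_str P c) = f (calg_str P c).
  by rewrite -(cmor_str i1) -[i1 _]mulr1 -(rmorph1 i2) fg.
apply: (tensor_ext (Q := Q) (f := f : calg_mod P -> Q) (g := g : calg_mod P -> Q) iT)
  => [a u v|a u v|m n].
- change (f (calg_str P a * u + v) = f (calg_str P a) * f u + f v).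
  by rewrite rmorphD rmorphM.
- change (g (calg_str P a * u + v) = f (calg_str P a) * g u + g v).
  by rewrite rmorphD rmorphM fgA.
- exact: fg.
Qed.

End Pushout.

(** * Vanishing of differentials passes up from level G/e *)

Lemma unit_transfer_tmor (gT : finGroupType) (R T : tambara gT) (f : tmor R T) alpha :
  unit_transfer alpha -> unit_transfer (f G1 alpha).
Proof.
move=> aP X; rewrite -(rmorph1 (f X)) -(aP X) rmorph_sum.
by apply: eq_bigr => x _; rewrite tmor_tr.
Qed.

(** The ideal J is the kernel of some f : P -> T, and T receives the image of [alpha], so f a = 0
    can be tested at G/e. There a restricts to a sum of products of kernel elements, which lie in
    J. *)
Lemma kahler_vanish_of_underlying (gT : finGroupType) (k : tambara gT) (R : talg k)
    (alpha : R G1) : unit_transfer alpha ->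
  ring_kahler_vanish (underlying_calg R) -> kahler_vanish R.
Proof.
move=> aP Rvan P i1 i2 mu box mult X a mua J [T [f fJ]] [JM _].
apply/fJ; apply: (unit_transfer_inj (unit_transfer_tmor f (unit_transfer_tmor i1 aP))) => x.
rewrite rmorph0 -tmor_res.
have : mu G1 (gres P (orb x) a) = 0 by rewrite tmor_res mua rmorph0.
move/(Rvan (underlying_calg P) (underlying_cmor i1) (underlying_cmor i2)
  (underlying_cmor mu) (box_tensor box) (mult G1)) => [s [sI ->]].
rewrite rmorph_sum big_seq big1 // => p /sI[p1 p2].
by apply/fJ; apply: (JM 1%G).
Qed.

(** * The box square as a fixed point functor *)

Lemma kcomp_res (gT : finGroupType) (k : green gT) (M N Q : kmod k)
  (h : kmor N Q) (g : kmor M N) X Y (f : gmap X Y) m :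
  (h X \o g X) (kres M f m) = kres Q f ((h Y \o g Y) m).
Proof. by rewrite /= !kmor_res. Qed.
Lemma kcomp_tr (gT : finGroupType) (k : green gT) (M N Q : kmod k)
  (h : kmor N Q) (g : kmor M N) X Y (f : gmap X Y) m :
  (h Y \o g Y) (ktr M f m) = ktr Q f ((h X \o g X) m).
Proof. by rewrite /= !kmor_tr. Qed.
Definition kcomp (gT : finGroupType) (k : green gT) (M N Q : kmod k)
  (h : kmor N Q) (g : kmor M N) : kmor M Q :=
  @KMor gT k M Q (fun X => h X \o g X) (@kcomp_res _ _ _ _ _ h g) (@kcomp_tr _ _ _ _ _ h g).

Section Gluing.
Context (gT : finGroupType) (T : tambara gT) (alpha : T G1).
Hypothesis alphaP : unit_transfer alpha.

(** Rebuilds an element from prescribed restrictions to points, by the formula of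
    [unit_transfer_decomp]. *)
Definition glue (X : gset gT) (F : X -> T G1) : T X :=
  \sum_x gtr T (orb x) (alpha * F x).

Lemma res_glue (X : gset gT) (F : X -> T G1) :
  (forall x g, F (gset_act X x g) = gres T (orb (gel g)) (F x)) ->
  forall y, gres T (orb y) (glue F) = F y.
Proof.
move=> FP y; rewrite /glue rmorph_sum /=.
under eq_bigr do rewrite (mackey_res_orb_tr (green_mackey T)).
rewrite (exchange_big_dep predT) //= -[RHS]mul1r -(unit_transfer_trace alphaP) mulr_suml.
(* Each a carries a single x to y, and equivariance moves F x to F y; the remaining factors are the
   conjugates of [alpha], of sum 1. *)
apply: eq_bigr => a _; rewrite (big_pred1 (gset_act X y (gpt a)^-1)%g) => [|x].
  by rewrite rmorphM -{2}[a]gptK -FP actKV.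
by apply/eqP/eqP => [<-|->]; rewrite ?actK ?actKV.
Qed.

End Gluing.

Lemma kpairing_mul (gT : finGroupType) (k : tambara gT) (R P : talg k) (i1 i2 : amor R P) :
  @kpairing gT k (talg_mod R) (talg_mod R) (talg_mod P)
    (fun X (a b : R X) => i1 X a * i2 X b).
Proof.
split.
- move=> X n a m m'.
  change (i1 X (talg_str R X a * m + m') * i2 X n =
    talg_str P X a * (i1 X m * i2 X n) + i1 X m' * i2 X n).
  by rewrite rmorphD rmorphM amor_str mulrDl mulrA.
- move=> X m a n n'.
  change (i1 X m * i2 X (talg_str R X a * n + n') =
    talg_str P X a * (i1 X m * i2 X n) + i1 X m * i2 X n').
  by rewrite rmorphD rmorphM amor_str mulrDr mulrCA.
- move=> X Y f m n.
  change (gres P f (i1 Y m * i2 Y n) = i1 X (gres R f m) * i2 X (gres R f n)).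
  by rewrite rmorphM -!tmor_res.
- move=> X Y f m n.
  change (i1 Y (gtr R f m) * i2 Y n = gtr P f (i1 X m * i2 X (gres R f n))).
  by rewrite tmor_tr tmor_res mulrC -green_frobenius mulrC.
- move=> X Y f m n.
  change (i1 Y m * i2 Y (gtr R f n) = gtr P f (i1 X (gres R f m) * i2 X n)).
  by rewrite tmor_tr tmor_res -green_frobenius.
Qed.

(** By transitivity some [x1] lies over y. The stabiliser of y has order |H| > |K|, so one of its
    elements moves [x1] within the fibre. *)
Lemma fibre_two (gT : finGroupType) (K H : {group gT}) (f : gmap (gorbit K) (gorbit H)) :
  (exists g : gT, (K :^ g)%g \proper H) ->
  forall y, exists x1 x2, [/\ x1 != x2, f x1 = y & f x2 = y].
Proof.
case=> g KH y.
have cP (L : {group gT}) (a b : gorbit L) : exists h, gset_act _ a h = b.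
  have /rcosetsP[x _ ax] := valP a; have /rcosetsP[z _ bz] := valP b.
  by exists (x^-1 * z)%g; apply: val_inj; rewrite /= ax bz -rcosetM mulKVg.
have KP : (K : {set gT}) \in rcosets K [set: gT].
  by apply/rcosetsP; exists 1%g; rewrite ?inE ?rcoset1.
pose c : gorbit K := exist (fun A => A \in rcosets K [set: gT]) _ KP.
have [h fh] := cP _ (f c) y.
pose x1 := gset_act _ c h; have fx1 : f x1 = y by rewrite /x1 gmapP.
have stab (L : {group gT}) (a : gorbit L) :
    exists z, forall t, (gset_act _ a t == a) = (t \in (L :^ z)%g).
  have /rcosetsP[z _ az] := valP a; exists z => t.
  rewrite -val_eqE /= az -rcosetM (sameP eqP rcoset_eqP) mem_rcoset mem_conjg.
  by rewrite conjgE invgK mulgA.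
have [zK stabK] := stab K x1; have [zH stabH] := stab H y.
have /subsetPn[t tH tK] : ~~ ((H :^ zH)%g \subset (K :^ zK)%g).
  apply/negP => /subset_leq_card; rewrite !cardJg leqNgt.
  by rewrite -(cardJg K g) proper_card.
exists x1, (gset_act _ x1 t); split=> //; first by rewrite eq_sym stabK.
by rewrite gmapP fx1; apply/eqP; rewrite stabH.
Qed.

(** * The fixed point functor of the tensor square of R(G/e) *)

Section KahlerUnderlying.
Context (gT : finGroupType) (k : tambara gT) (R : talg k) (alpha : R G1).
Hypothesis alphaP : unit_transfer alpha.
Context (P : calg (k G1)) (i1 i2 : cmor (underlying_calg R) P)
  (mu : cmor P (underlying_calg R)).
Hypothesis iT : @is_tensor _ (calg_mod (underlying_calg R))
  (calg_mod (underlying_calg R)) (calg_mod P)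
  (fun a b : underlying_calg R => i1 a * i2 b).
Hypothesis muE : forall a b : underlying_calg R, mu (i1 a * i2 b) = a * b.
Implicit Types X Y : gset gT.

Local Notation rg g := (gres R (orb (gel g))).
Local Notation A := (underlying_calg R).

Lemma diag_exists g : exists sg : {rmorphism P -> P},
  forall a b : A, sg (i1 a * i2 b) = i1 (rg g a) * i2 (rg g b).
Proof.
pose r : {rmorphism A -> A} := gres R (orb (gel g)).
apply: (pushout_exists iT (f1 := i1 \o r) (f2 := i2 \o r)) => c.
change (i1 (rg g (talg_str R G1 c)) = i2 (rg g (talg_str R G1 c))).
by rewrite -tmor_res (cmor_str i1) (cmor_str i2).
Qed.

(** The diagonal action of G on the tensor square, picked by [cid] because the pushout property only
    asserts existence. *)
Definition diag g : {rmorphism P -> P} := sval (cid (diag_exists g)).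
Lemma diagE g (a b : A) : diag g (i1 a * i2 b) = i1 (rg g a) * i2 (rg g b).
Proof. exact: (svalP (cid (diag_exists g))). Qed.
Lemma diag_i1 g (a : A) : diag g (i1 a) = i1 (rg g a).
Proof. by rewrite -[i1 a]mulr1 -(rmorph1 i2) diagE !rmorph1 mulr1. Qed.
Lemma diag_i2 g (a : A) : diag g (i2 a) = i2 (rg g a).
Proof. by rewrite -[i2 a]mul1r -(rmorph1 i1) diagE !rmorph1 mul1r. Qed.
Lemma diag_str g c : diag g (calg_str P c) = calg_str P (gres k (orb (gel g)) c).
Proof. by rewrite -!(cmor_str i1) diag_i1 -tmor_res. Qed.

Lemma rgM g h (a : R G1) : rg (g * h)%g a = rg h (rg g a).
Proof. by rewrite -gel_act -gcomp_orb_gel (mackey_res_comp (green_mackey R)). Qed.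

Lemma diag1 : diag 1%g =1 idfun.
Proof.
apply: (pushout_ext iT) => a b; rewrite diagE orb1.
by rewrite !(mackey_res_id (green_mackey R)).
Qed.
Lemma diagM g h p : diag (g * h)%g p = diag h (diag g p).
Proof.
apply: (pushout_ext iT (f := diag (g * h)%g) (g := diag h \o diag g)) => a b /=.
by rewrite !diagE !rgM.
Qed.
Lemma mu_diag g p : mu (diag g p) = rg g (mu p).
Proof.
apply: (pushout_ext iT (f := mu \o diag g) (g := gres R (orb (gel g)) \o mu)) => a b /=.
by rewrite diagE !muE rmorphM.
Qed.

Lemma fix_str_subproof g c : g \in [set: gT] ->
  calg_str P (gres k (orb (gel g)) c) = diag g (calg_str P c).
Proof. by rewrite diag_str. Qed.
Definition fix_alg : talg k := TAlg (transpose fix_str_subproof).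

Section Inclusion.
Variable i : cmor A P.
Hypothesis iS : forall g (a : A), diag g (i a) = i (rg g a).
Lemma fix_incl_subproof g (a : R G1) : g \in [set: gT] -> i (rg g a) = diag g (i a).
Proof. by rewrite iS. Qed.
Lemma fix_incl_str X a :
  transpose fix_incl_subproof X (talg_str R X a) = talg_str fix_alg X a.
Proof.
apply: ev_ext => x; rewrite [LHS]ev_transpose [RHS]ev_transpose -tmor_res.
exact: (cmor_str i).
Qed.
Definition fix_incl : amor R fix_alg :=
  @AMor gT k R fix_alg (transpose fix_incl_subproof) fix_incl_str.
Lemma ev_fix_incl X (a : R X) x : ev (fix_incl X a) x = i (gres R (orb x) a).
Proof. exact: ev_transpose. Qed.
End Inclusion.

Definition fix_i1 := fix_incl diag_i1.
Definition fix_i2 := fix_incl diag_i2.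

(** Multiplication takes place at each point; the values are equivariant by [mu_diag], hence glue to
    an element of R(X). *)
Definition fix_mu_fun X (psi : fix_alg X) : R X := glue alpha (fun x => mu (ev psi x)).

Lemma res_mu X (psi : fix_alg X) x : gres R (orb x) (fix_mu_fun psi) = mu (ev psi x).
Proof.
by apply: (res_glue alphaP) => {}x g; rewrite ev_act ?inE // mu_diag.
Qed.

Lemma fix_mu_is_zmod_morphism X : zmod_morphism (@fix_mu_fun X).
Proof.
move=> u v; apply: (unit_transfer_inj alphaP) => x.
by rewrite rmorphB !res_mu evB rmorphB.
Qed.
Lemma fix_mu_is_monoid_morphism X : monoid_morphism (@fix_mu_fun X).
Proof.
split=> [|u v]; apply: (unit_transfer_inj alphaP) => x.
  by rewrite res_mu ev1 !rmorph1.
by rewrite rmorphM !res_mu evM rmorphM.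
Qed.
HB.instance Definition _ X :=
  GRing.isZmodMorphism.Build _ _ (@fix_mu_fun X) (@fix_mu_is_zmod_morphism X).
HB.instance Definition _ X :=
  GRing.isMonoidMorphism.Build _ _ (@fix_mu_fun X) (@fix_mu_is_monoid_morphism X).

Definition fix_mu_tmor : tmor fix_alg R.
Proof.
apply: (@TMor gT fix_alg R (fun X => @fix_mu_fun X)) => X Y f a;
  apply: (unit_transfer_inj alphaP) => y /=.
- by rewrite -(mackey_res_comp (green_mackey R)) gcomp_orb !res_mu ev_res.
- rewrite (mackey_res_orb_tr (green_mackey R)) res_mu ev_tr rmorph_sum.
  by apply: eq_bigr => x _; rewrite res_mu.
- rewrite res_orb_nm res_mu ev_nm rmorph_prod.
  by apply: eq_bigr => x _; rewrite res_mu.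
Defined.
Lemma fix_mu_str X a : fix_mu_tmor X (talg_str fix_alg X a) = talg_str R X a.
Proof.
apply: (unit_transfer_inj alphaP) => x; rewrite [LHS]res_mu [ev _ _]ev_transpose.
by rewrite -tmor_res; apply: (cmor_str mu).
Qed.
Definition fix_mu : amor fix_alg R := AMor fix_mu_str.

Lemma fix_mult : is_multiplication fix_i1 fix_i2 fix_mu.
Proof.
move=> X a b; apply: (unit_transfer_inj alphaP) => x.
by rewrite [LHS]res_mu evM !ev_fix_incl muE rmorphM.
Qed.

Lemma fix_orbit_subproof p (a : G1) g : g \in [set: gT] ->
  diag (gpt (gset_act G1 a g)) p = diag g (diag (gpt a) p).
Proof. by rewrite gpt_act diagM. Qed.
(** Inverse to evaluation at the base point; it identifies P with level G/e of [fix_alg]. *)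
Definition fix_orbit p : fix_alg G1 := mkeqfun (fix_orbit_subproof p).
Lemma ev_fix_orbit p a : ev (fix_orbit p) a = diag (gpt a) p.
Proof. exact: ev_mk. Qed.
Lemma ev_fix_orbit1 p : ev (fix_orbit p) (gel 1%g) = p.
Proof. by rewrite ev_fix_orbit gelK diag1. Qed.
Lemma fix_orbit_ev (psi : fix_alg G1) : fix_orbit (ev psi (gel 1%g)) = psi.
Proof.
apply: ev_ext => a; rewrite ev_fix_orbit -ev_act ?inE //.
by rewrite gel_act mul1g gptK.
Qed.

Lemma fix_ev_linear : linear (fun psi : talg_mod fix_alg G1 =>
  ev (psi : fix_alg G1) (gel 1%g) : calg_mod P).
Proof.
move=> a u v.
change (ev (talg_str fix_alg G1 a * u + v) (gel 1%g) =
  calg_str P a * ev (u : fix_alg G1) (gel 1%g) + ev (v : fix_alg G1) (gel 1%g)).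
by rewrite evD evM [ev (talg_str fix_alg _ _) _]ev_transpose gres_orb1.
Qed.

Lemma fix_orbit_linear : linear (fun p : calg_mod P => fix_orbit p : talg_mod fix_alg G1).
Proof.
move=> a u v; apply: ev_ext => x.
change (ev (fix_orbit (calg_str P a * u + v)) x =
  ev (talg_str fix_alg G1 a * fix_orbit u + fix_orbit v) x).
rewrite evD evM !ev_fix_orbit rmorphD rmorphM diag_str.
by rewrite [ev (talg_str fix_alg _ _) _]ev_transpose gptK.
Qed.

(** A pairing s factors at G/e through [h0]. At level X the values of a function are weighted by
    [alpha], sent through [h0] and transferred up; decomposing the first argument of s shows that
    this factors s. *)
Lemma fix_box : is_box_square fix_i1 fix_i2.
Proof.
split=> [|Q s sP]; first exact: kpairing_mul.
have [h0 [h0E h0U]] := iT.2 _ _ (kpairing_bilinear G1 sP).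
have HP : linear (fun p : calg_mod P => h0 (i1 alpha * (p : P))).
  move=> a u v; rewrite -linearP; congr (h0 _).
  change (i1 alpha * (calg_str P a * (u : P) + v) =
    calg_str P a * (i1 alpha * u) + i1 alpha * v).
  by rewrite mulrDr mulrCA.
pose H : {linear calg_mod P -> Q G1} := HB.pack_for {linear calg_mod P -> Q G1}
  (fun p : calg_mod P => h0 (i1 alpha * (p : P))) (GRing.isLinear.Build _ _ _ _ _ HP).
pose E : {linear talg_mod fix_alg G1 -> calg_mod P} :=
  HB.pack_for {linear talg_mod fix_alg G1 -> calg_mod P}
  (fun psi : talg_mod fix_alg G1 => ev (psi : fix_alg G1) (gel 1%g) : calg_mod P)
  (GRing.isLinear.Build _ _ _ _ _ fix_ev_linear).
(* The colift includes equivariant functions into all functions, and the lift transfers their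
   weighted values. *)
pose h := kcomp (ind_lift H) (ind_colift E).
have hE X psi : h X psi = \sum_x ktr Q (orb x) (h0 (i1 alpha * ev (psi : fix_alg X) x)).
  rewrite [LHS]ind_liftE; apply: eq_bigr => x _; rewrite ind_coliftE.
  by congr (ktr Q _ (h0 (_ * _))); rewrite [LHS]ev_res orb_gel1.
have hs X m n : h X (fix_i1 X m * fix_i2 X n) = s X m n.
  rewrite hE {2}(unit_transfer_decomp alphaP m) (bilinear_suml (kpairing_bilinear X sP)).
  apply: eq_bigr => x _; rewrite [RHS](kpairing_trl sP); congr (ktr Q _ _).
  by rewrite evM !ev_fix_incl mulrA -rmorphM h0E.
exists h; split=> // h' h'E X psi.
(* Uniqueness: level G/e is forced by the tensor product, and the other levels by decomposing [psi]
   into transfers from it. *)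
have h'1 (phi : fix_alg G1) : h' G1 phi = h0 (ev phi (gel 1%g)).
  rewrite -{1}[phi]fix_orbit_ev; move: (ev phi _) => p.
  apply: (tensor_ext (f := fun p : calg_mod P => h' G1 (fix_orbit p)) (g := h0) iT).
  - by move=> a u v; rewrite fix_orbit_linear linearP.
  - exact: linearP.
  - move=> m n; rewrite h0E -h'E; congr (h' G1 _); apply: ev_ext => x.
    by rewrite ev_fix_orbit evM !ev_fix_incl diagE gptK.
rewrite hE [in LHS](unit_transfer_decomp (unit_transfer_tmor fix_i1 alphaP) psi) linear_sum.
apply: eq_bigr => x _; rewrite kmor_tr h'1; congr (ktr Q _ (h0 _)).
by rewrite evM ev_fix_incl ev_res orb_gel1 gres_orb1.
Qed.

(** * The square of the kernel at level G/e *)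

Lemma ideal_square_mul (S S' : comPzRingType) (f : {rmorphism S -> S'}) a b :
  f a = 0 -> f b = 0 -> ideal_square (fun x => f x = 0) (a * b).
Proof.
move=> fa fb; exists [:: (a, b)]; split=> [p|]; last by rewrite big_seq1.
by rewrite inE => /eqP ->.
Qed.

Lemma kernel_in_square : kahler_vanish R -> forall p, mu p = 0 ->
  ideal_square (fun a => mu a = 0) p.
Proof.
move=> van p mup.
have [] := @quotient_ring P (ideal_square (fun a => mu a = 0)).
- by exists [::]; rewrite big_nil.
- move=> a b [s [sI ->]] [t [tI ->]]; exists (s ++ t); rewrite big_cat; split=> // q.
  by rewrite mem_cat => /orP[/sI|/tI].
- move=> a b [s [sI ->]]; exists [seq (a * q.1, q.2) | q <- s]; split=> [q|].
    by case/mapP => r /sI[r1 r2] -> /=; rewrite rmorphM r1 mulr0.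
  by rewrite big_map mulr_sumr; apply: eq_bigr => q _ /=; rewrite mulrA.
move=> Q [pi piE].
(* Pointwise reduction modulo the square of the kernel, forgetting equivariance. Being a Tambara
   morphism, it makes the functions with values in that square a Tambara ideal. *)
pose f : tmor fix_alg (coind_tambara gT Q) := coind_tmor (pi \o @ev_at _ _ _ _ G1 (gel 1%g)).
have fE X (psi : fix_alg X) x : ev (f X psi) x = pi (ev psi x).
  by rewrite ev_coind_tmor /= [ev_at _ _]ev_res orb_gel1.
have fI X (psi : fix_alg X) :
    f X psi = 0 <-> forall x, ideal_square (fun a => mu a = 0) (ev psi x).
  split=> [h x|h]; first by apply/piE; rewrite -fE h ev0.
  by apply: ev_ext => x; rewrite fE ev0; apply/piE.
have muI X (psi : fix_alg X) x : fix_mu X psi = 0 -> mu (ev psi x) = 0.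
  by move=> h; rewrite -res_mu [fix_mu_fun _]h rmorph0.
have /fI/(_ (gel 1%g)) : f G1 (fix_orbit p) = 0; last by rewrite ev_fix_orbit1.
have mu0 : tkernel fix_mu (fix_orbit p).
  apply: (unit_transfer_inj alphaP) => x.
  by rewrite [LHS]res_mu ev_fix_orbit mu_diag mup !rmorph0.
apply: (van fix_alg fix_i1 fix_i2 fix_mu fix_box fix_mult _ _ mu0 (tkernel f)).
  by exists (coind_tambara gT Q), f.
split=> [H a b /muI a0 /muI b0|K H g KH a /muI a0]; apply/fI => x.
  by rewrite evM; apply: ideal_square_mul.
(* The fibre supplies two distinct factors in the kernel, so the norm takes values in its square. *)
have [x1 [x2 [x12 gx1 gx2]]] := fibre_two g KH x.
rewrite ev_nm (bigD1 x1) ?gx1 //=; apply: ideal_square_mul; first exact: a0.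
by rewrite (bigD1 x2) ?gx2 ?eqxx 1?eq_sym //= rmorphM a0 mul0r.
Qed.

End KahlerUnderlying.

(** * Comparison of the two etale conditions *)

Lemma ring_kahler_vanish_underlying (gT : finGroupType) (k : tambara gT) (R : talg k)
    (alpha : R G1) : unit_transfer alpha ->
  kahler_vanish R -> ring_kahler_vanish (underlying_calg R).
Proof.
move=> aP van P i1 i2 mu iT muE p.
exact: (kernel_in_square aP iT muE van).
Qed.

(** In the cohomological case the inverse u of |G| is restricted to G/e, and transferring back
    multiplies it by |G|. In the other case any preimage of 1 under the transfer from G/e to G/G
    serves. *)
Lemma unit_transfer_exists (gT : finGroupType) (R : tambara gT) :
  cohomological R /\ order_invertible R \/ transfers_surjective R ->
  exists alpha : R G1, unit_transfer alpha.
Proof.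
case=> [[coh [u uG]]|surj].
  exists (gres R (gproj (sub1G [set: gT]%G)) u); apply: unit_transferP.
  by rewrite coh indexg1 cardsT -uG mulr_natr.
have [alpha ?] := surj _ _ (sub1G [set: gT]%G) 1.
by exists alpha; apply: unit_transferP.
Qed.

Theorem theorem5 (gT : finGroupType) (k : tambara gT) (l : talg k)
  (hflat : tflat l) (hfp : finitely_presented l)
  (hl : cohomological l /\ order_invertible l \/ transfers_surjective l) :
  etale l <-> ring_etale (underlying_calg l).
Proof.
have [alpha alphaP] := unit_transfer_exists hl; split=> [[[_ van] _]|[_ _ van]].
  split; [exact: (flat_underlying hflat) | exact: finitely_presented_underlying |].
  exact: (ring_kahler_vanish_underlying alphaP).
by split=> //; split=> //; apply: (kahler_vanish_of_underlying alphaP).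
Qed.
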